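(* Let $A$ be an operator space in $\mathbb{B}(\mathcal{H})$ and let $T : A \times A \longrightarrow \mathbb{C}$ be a bilinear form. Then the following are equivalent: (1) $\|T\|_{{wh'}^*} \le 1$. (2) There exists a state $p_0$ on $C^*(A)$ such that $|T(x,y)| \le p_0(x^*x)^{1/2}\, p_0(y^*y)^{1/2}$ for all $x,y\in A$. (3) There exist a $*$-representation $\pi : C^*(A) \longrightarrow \mathbb{B}(\mathcal{K})$ on a Hilbert space $\mathcal{K}$, a unit vector $\xi\in\mathcal{K}$ and a (linear) contraction $b : \mathcal{K}\longrightarrow\overline{\mathcal{K}}$ such that $T(x,y) = (b\,\pi(y)\xi \mid \overline{\pi(x)\xi})_{\overline{\mathcal{K}}}$ for all $x,y\in A$. (4) There exist a Hilbert space $\mathcal{K}$, a completely bounded map $a : A\longrightarrow\mathcal{K}_c$ and a bounded map $b : \mathcal{K}_c \longrightarrow (\mathcal{K}_c)^*$ such that, as a map $A\longrightarrow A^*$, $T = a^t b a$ and $\|a\|_{cb}^2\,\|b\| \le 1$.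
   Context: $\mathbb{B}(\mathcal{H})$ is the algebra of bounded operators on a Hilbert space $\mathcal{H}$; an operator space $A$ in $\mathbb{B}(\mathcal{H})$ is a linear subspace with the inherited matrix norms, and $C^*(A)$ is the $C^*$-algebra in $\mathbb{B}(\mathcal{H})$ generated by $A$. Inner products $(\cdot\mid\cdot)$ are linear in the first variable. For $u$ in the algebraic tensor product $A\otimes A$ put $$\|u\|_{wh'} = \inf\Big\{ \tfrac12 \big\|[x_1,\dots,x_n,y_1,\dots,y_n]^t\big\|^2 \;\Big|\; u=\sum_{i=1}^n x_i\otimes y_i,\ x_i,y_i\in A\Big\},$$ where $[x_1,\dots,x_n,y_1,\dots,y_n]^t$ is a column in $M_{2n,1}(A)$, so that its squared norm is $\|\sum_i (x_i^*x_i+y_i^*y_i)\|$. A bilinear form $T$ on $A\times A$ is identified with the linear form $x\otimes y\mapsto T(x,y)$ on $A\otimes A$ and with the linear map $T:A\to A^*$ given by $\langle x,T(y)\rangle=T(x,y)$. $\|T\|_{{wh'}^*}$ is the norm of the linear form $T$ when $A\otimes A$ carries $\|\cdot\|_{wh'}$. $\overline{\mathcal{K}}$ is the conjugate Hilbert space of $\mathcal{K}$, with elements $\overline{\eta}$, $\eta\in\mathcal{K}$. $\mathcal{K}_c$ is the column Hilbert space: $\mathcal{K}$ with the operator space structure in which, for $\xi=[\xi_{ij}]\in M_n(\mathcal{K})$, the norm is the operator norm of $\mathbb{C}^n\ni[\lambda_1,\dots,\lambda_n]\mapsto[\sum_j\lambda_j\xi_{ij}]_i\in\mathcal{K}^n$.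 As a Banach space $(\mathcal{K}_c)^*=\overline{\mathcal{K}}$, and the transposed map $a^t:(\mathcal{K}_c)^*\to A^*$ of $a$ is given by $\langle a^t(\overline\eta),x\rangle=\langle\overline\eta,a(x)\rangle=(\overline\eta\mid\overline{a(x)})_{\overline{\mathcal{K}}}$ for $\overline\eta\in\overline{\mathcal{K}}$, $x\in A$. $\|\cdot\|_{cb}$ is the completely bounded norm and $\|b\|$ is the ordinary operator norm. *)

(* Defs.v *)
From HB Require Import structures.
From mathcomp Require Import all_boot all_order all_algebra sesquilinear.
From mathcomp Require Import all_classical all_reals all_analysis.
From mathcomp Require Export complex.

Set Implicit Arguments.
Unset Strict Implicit.
Unset Printing Implicit Defensive.

Import Order.TTheory GRing.Theory Num.Theory.
Import numFieldNormedType.Exports.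

Local Open Scope classical_set_scope.
Local Open Scope ring_scope.
Local Open Scope quotient_scope.

(* {dot H for Num.conj}: linear in the first variable, conjugate-linear in the
   second one. *)
HB.mixin Record isHilbert (R : realType) H & CompleteNormedModule R[i] H := {
  inner : {dot H for (@Num.conj R[i])};
  inner_norm : forall x : H, inner x x = `|x| ^+ 2
}.

#[short(type="hilbertType")]
HB.structure Definition Hilbert (R : realType) :=
  {H of isHilbert R H & CompleteNormedModule R[i] H}.

(* The norm of a complex normed space takes its values in the scalar field
   R[i]; [rnorm] is the same norm as an element of R. *)
Definition rnorm (R : realType) (V : normedZmodType R[i]) (x : V) : R :=
  complex.Re `|x|.

Lemma rnormE (R : realType) (V : normedZmodType R[i]) (x : V) :
  `|x| = (rnorm x)%:C%C.
Proof. by rewrite /rnorm RRe_real// ger0_real. Qed.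

Lemma rnorm_ge0 (R : realType) (V : normedZmodType R[i]) (x : V) :
  0 <= rnorm x.
Proof. by rewrite -lecR -rnormE normr_ge0. Qed.

Definition conjugate (K : Type) : Type := K.

Definition bar (K : Type) (x : K) : conjugate K := x.

Section Conjugate.
Variables (R : realType) (K : hilbertType R).

HB.instance Definition _ := PseudoMetricNormedZmod.copy (conjugate K) K.
HB.instance Definition _ := Complete.copy (conjugate K) K.

Definition conj_scale (a : R[i]) (x : conjugate K) : conjugate K :=
  bar (a^* *: (x : K)).

Let conj_scaleA a b x :
  conj_scale a (conj_scale b x) = conj_scale (a * b) x.
Proof. by rewrite /conj_scale /bar scalerA rmorphM. Qed.

Let conj_scale1 : left_id 1 conj_scale.
Proof. by move=> x; rewrite /conj_scale /bar rmorph1 scale1r. Qed.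

Let conj_scaleDr : right_distributive conj_scale +%R.
Proof. by move=> a x y; rewrite /conj_scale /bar scalerDr. Qed.

Let conj_scaleDl x : {morph conj_scale^~ x : a b / a + b}.
Proof. by move=> a b; rewrite /conj_scale /bar rmorphD scalerDl. Qed.

HB.instance Definition _ := GRing.Zmodule_isLmodule.Build R[i] (conjugate K)
  conj_scaleA conj_scale1 conj_scaleDr conj_scaleDl.

Let conj_normZ (a : R[i]) (x : conjugate K) : `|a *: x| = `|a| * `|x|.
Proof. by rewrite -(norm_conjC a); exact: (@normrZ _ K). Qed.

HB.instance Definition _ :=
  PseudoMetricNormedZmod_Lmodule_isNormedModule.Build R[i] (conjugate K)
    conj_normZ.

Definition conj_inner (x y : conjugate K) : R[i] := inner (y : K) (x : K).

Let conj_inner_bilinear :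
  bilinear_for *%R ((@Num.conj R[i]) \; *%R) conj_inner.
Proof.
split=> [u a x y | u a x y]; rewrite /conj_inner.
  have := linearPr (inner : {dot K for _}) (u : K) (a^*) (x : K) (y : K).
  by rewrite /= conjCK.
exact: (linearPl (inner : {dot K for _}) (u : K) (a^*) (x : K) (y : K)).
Qed.

HB.instance Definition _ :=
  bilinear_isBilinear.Build R[i] (conjugate K) (conjugate K) R[i]
    *%R ((@Num.conj R[i]) \; *%R) conj_inner conj_inner_bilinear.

Let conj_inner_hermitian x y :
  conj_inner x y = (-1) ^+ false * (conj_inner y x)^*.
Proof. exact: (@hermitian_subproof _ K false _ (inner : {dot K for _}) y x). Qed.

HB.instance Definition _ :=
  isHermitianSesquilinear.Build R[i] (conjugate K) false (@Num.conj R[i])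
    conj_inner conj_inner_hermitian.

Let conj_inner_gt0 (x : conjugate K) : x != 0 -> 0 < conj_inner x x.
Proof. exact: (@neq0_dnorm_gt0 _ K _ (inner : {dot K for _}) x). Qed.

HB.instance Definition _ :=
  isDotProduct.Build R[i] (conjugate K) conj_inner conj_inner_gt0.

Let conj_inner_norm (x : conjugate K) : conj_inner x x = `|x| ^+ 2.
Proof. exact: (@inner_norm R K). Qed.

HB.instance Definition _ :=
  isHilbert.Build R (conjugate K) conj_inner_norm.

End Conjugate.

Section BoundedOperators.
Variables (R : realType) (U V : normedModType R[i]).

Definition bounded_linear : {pred U -> V} :=
  [pred f : U -> V | `[< linear f /\
     exists M : R, forall x, rnorm (f x) <= M * rnorm x >]].

Fact bounded_linear_submod : submod_closed bounded_linear.
Proof.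
split=> [|a f g].
  apply/asboolP; split=> [b x y|]; first by rewrite /= scaler0 addr0.
  by exists 0; move=> x; rewrite mul0r /rnorm [`|_|]normr0; exact: lexx.
move=> /asboolP[lf [M fM]] /asboolP[lg [N gN]]; apply/asboolP; split.
  move=> b x y.
  suff: a *: f (b *: x + y) + g (b *: x + y) =
        b *: (a *: f x + g x) + (a *: f y + g y) by [].
  by rewrite lf lg !scalerDr !scalerA (mulrC a b) addrACA.
exists (rnorm a * M + N); move=> x.
have nM := ler_normD (a *: f x) (g x); rewrite normrZ in nM.
rewrite -lecR -!rnormE; apply: (le_trans nM).
rewrite (rnormE a) !rnormE -!rmorphM -!rmorphD /= lecR.
by rewrite mulrDl -mulrA lerD ?ler_wpM2l// rnorm_ge0.
Qed.

HB.instance Definition _ := GRing.isSubmodClosed.Build R[i] (U -> V)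
  bounded_linear bounded_linear_submod.

Record bop : Type := Bop { bop_val :> U -> V ; _ : bop_val \in bounded_linear }.

HB.instance Definition _ := [isSub for bop_val].
HB.instance Definition _ := [Choice of bop by <:].
HB.instance Definition _ := [SubChoice_isSubLmodule of bop by <:].

Fact bop_linear (f : bop) : linear f.
Proof. by have /asboolP[] := valP f. Qed.

HB.instance Definition _ (f : bop) :=
  GRing.isLinear.Build R[i] U V *:%R f (bop_linear f).

Definition opnorm (f : bop) : R :=
  sup [set rnorm (f x) | x in [set x : U | rnorm x <= 1]].

End BoundedOperators.

Notation "''B' ( H )" := (bop H H) (at level 8, format "''B' ( H )").

Section OperatorAlgebra.
Variables (R : realType) (H : hilbertType R).

Fact opmul_bounded (x y : 'B(H)) : x \o y \in @bounded_linear R H H.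
Proof.
have /asboolP[_ [M xM]] := valP x; have /asboolP[_ [N yN]] := valP y.
apply/asboolP; split=> [a u v|]; first by rewrite /= !linearP.
exists (`|M| * N); move=> u /=; apply: le_trans (xM _) _.
rewrite -mulrA; apply: le_trans (ler_wpM2l (normr_ge0 M) (yN u)).
by rewrite ler_wpM2r ?rnorm_ge0 ?ler_norm.
Qed.

Definition opmul (x y : 'B(H)) : 'B(H) := Bop (opmul_bounded x y).

(* The adjoint of x: it exists (Riesz) and is unique, so the default
   value 0 is never used. *)
Definition is_adjoint (x z : 'B(H)) :=
  forall u v : H, inner (x u) v = inner u (z v).

Definition opadj (x : 'B(H)) : 'B(H) := xget 0 (is_adjoint x).

End OperatorAlgebra.

Section Subspace.
Variables (F : pzRingType) (V : lmodType F).

Definition subspace_type (A : submodClosed V) : Type := {x : V | x \in A}.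

Variable A : submodClosed V.
HB.instance Definition _ := SubChoice.on (subspace_type A).
HB.instance Definition _ := [SubChoice_isSubLmodule of subspace_type A by <:].

End Subspace.

Coercion subspace_type : submodClosed >-> Sortclass.

Section GeneratedCstarAlgebra.
Variables (R : realType) (H : hilbertType R).

(* C*-subalgebras are not required to contain the identity of B(H). *)
Definition cstar_subalgebra (S : {pred 'B(H)}) :=
  [/\ submod_closed S,
      {in S &, forall x y, opmul x y \in S},
      {in S, forall x, opadj x \in S} &
      forall x, (forall e : R, 0 < e ->
                   exists2 y, y \in S & opnorm (x - y) < e) -> x \in S].

Variable A : submodClosed 'B(H).

Definition cstar_pred : {pred 'B(H)} :=
  [pred x | `[< forall S : {pred 'B(H)},
                  cstar_subalgebra S -> {subset A <= S} -> x \in S >]].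

Fact cstar_predP : cstar_subalgebra cstar_pred.
Proof.
split=> [|x y /asboolP Cx /asboolP Cy|x /asboolP Cx|x Cx].
- split=> [|a x y /asboolP Cx /asboolP Cy]; apply/asboolP => S CS AS.
    by have [[]] := CS.
  by have [[_ CSl] _ _ _] := CS; apply: CSl; [exact: Cx | exact: Cy].
- apply/asboolP => S CS AS; have [_ CSm _ _] := CS.
  by apply: CSm; [exact: Cx | exact: Cy].
- by apply/asboolP => S CS AS; have [_ _ + _] := CS; apply; exact: Cx.
- apply/asboolP => S CS AS; have [_ _ _ +] := CS; apply=> e e0.
  by have [y /asboolP Cy xy] := Cx e e0; exists y => //; exact: Cy.
Qed.

Fact cstar_submod : submod_closed cstar_pred.
Proof. by have [] := cstar_predP. Qed.

HB.instance Definition _ :=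
  GRing.isSubmodClosed.Build R[i] 'B(H) cstar_pred cstar_submod.

Definition cstar : submodClosed 'B(H) := cstar_pred.

Fact cstar_incl_subproof (x : A) : val x \in cstar.
Proof. by apply/asboolP => S _ AS; exact/AS/(valP x). Qed.

Fact cstar_mul_subproof (x y : cstar) : opmul (val x) (val y) \in cstar.
Proof. by have [_ + _ _] := cstar_predP; apply; exact: valP. Qed.

Fact cstar_adj_subproof (x : cstar) : opadj (val x) \in cstar.
Proof. by have [_ _ + _] := cstar_predP; apply; exact: valP. Qed.

Definition cstar_incl (x : A) : cstar :=
  exist _ (val x) (cstar_incl_subproof x).
Definition cstar_mul (x y : cstar) : cstar :=
  exist _ (opmul (val x) (val y)) (cstar_mul_subproof x y).
Definition cstar_adj (x : cstar) : cstar :=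
  exist _ (opadj (val x)) (cstar_adj_subproof x).

Definition is_state (p : {scalar cstar}) :=
  (forall x, 0 <= p (cstar_mul (cstar_adj x) x)) /\
  ereal_sup [set (rnorm (p x))%:E | x in [set x : cstar | opnorm (val x) <= 1]]
    = 1%E.

Definition is_star_rep (K : hilbertType R) (pi : {linear cstar -> 'B(K)}) :=
  (forall x y, pi (cstar_mul x y) = opmul (pi x) (pi y)) /\
  (forall x, pi (cstar_adj x) = opadj (pi x)).

End GeneratedCstarAlgebra.

Section MatrixNorms.
Variables (R : realType).

Definition l2norm n (V : normedZmodType R[i]) (v : 'cV[V]_n) : R :=
  Num.sqrt (\sum_i rnorm (v i 0) ^+ 2).

(* M_(m,n)(B(H)) is normed as the space of bounded operators H^n -> H^m. *)
Definition opmxnorm (H : hilbertType R) m n (X : 'M['B(H)]_(m, n)) : R :=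
  sup [set l2norm (\col_i \sum_j X i j (v j 0))
      | v in [set v : 'cV[H]_n | l2norm v <= 1]].

Definition submxnorm (H : hilbertType R) (A : submodClosed 'B(H)) m n
  (X : 'M[A]_(m, n)) : R := opmxnorm (map_mx val X).

(* The matrix norms of the column Hilbert space K_c: X = [xi_ij] is normed as
   the operator C^n -> K^n, l |-> [sum_j l_j xi_ij]_i. *)
Definition colmxnorm (K : hilbertType R) n (X : 'M[K]_n) : R :=
  sup [set l2norm (\col_i \sum_j l j 0 *: X i j)
      | l in [set l : 'cV[R[i]]_n | l2norm l <= 1]].

Definition cbnorm (H : hilbertType R) (A : submodClosed 'B(H))
    (K : hilbertType R) (a : A -> K) : \bar R :=
  ereal_sup [set z | exists n (X : 'M[A]_n),
    submxnorm X <= 1 /\ z = (colmxnorm (map_mx a X))%:E].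

End MatrixNorms.

Section Tensor.
Variables (F : nzRingType) (U V : lmodType F).

(* Finite sums x_1 (x) y_1 + ... + x_n (x) y_n are lists of pairs, with
   concatenation as addition, modulo the congruence generated by
   commutativity and the bilinearity relations. *)
Inductive tensor_eq : seq (U * V) -> seq (U * V) -> Prop :=
| tensor_refl s : tensor_eq s s
| tensor_sym s t : tensor_eq s t -> tensor_eq t s
| tensor_trans s t r : tensor_eq s t -> tensor_eq t r -> tensor_eq s r
| tensor_cat s s' t t' :
    tensor_eq s s' -> tensor_eq t t' -> tensor_eq (s ++ t) (s' ++ t')
| tensor_comm s t : tensor_eq (s ++ t) (t ++ s)
| tensor_zero y : tensor_eq [:: (0, y)] [::]
| tensor_addl x x' y : tensor_eq [:: (x + x', y)] [:: (x, y); (x', y)]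
| tensor_addr x y y' : tensor_eq [:: (x, y + y')] [:: (x, y); (x, y')]
| tensor_scale a x y : tensor_eq [:: (a *: x, y)] [:: (x, a *: y)].

Definition tensor_rel : rel (seq (U * V)) := fun s t => `[< tensor_eq s t >].

Fact tensor_rel_equiv : equiv_class_of tensor_rel.
Proof.
split=> [s|s t|t s r].
- by apply/asboolP; exact: tensor_refl.
- by apply/asboolP/asboolP => ?; exact: tensor_sym.
- by move=> /asboolP st /asboolP tr; apply/asboolP; exact: tensor_trans st tr.
Qed.

Canonical tensor_equiv := EquivRelPack tensor_rel_equiv.

Definition tensor := {eq_quot tensor_equiv}.

End Tensor.

Section WhNorm.
Variables (R : realType) (H : hilbertType R) (A : submodClosed 'B(H)).

Definition tensor_sum n (x y : 'cV[A]_n) : tensor A A :=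
  \pi_(tensor A A) [seq (x i 0, y i 0) | i : 'I_n].

Definition whnorm (u : tensor A A) : R :=
  inf [set z | exists n (x y : 'cV[A]_n),
    u = tensor_sum x y /\ z = 2^-1 * submxnorm (col_mx x y) ^+ 2].

(* The linear form on the tensor product given by a bilinear form T; by
   bilinearity it does not depend on the chosen representative. *)
Definition tensor_form (T : {biscalar A}) (u : tensor A A) : R[i] :=
  \sum_(xy <- repr u) T xy.1 xy.2.

Definition whdualnorm (T : {biscalar A}) : \bar R :=
  ereal_sup [set (rnorm (tensor_form T u))%:E | u in [set u | whnorm u <= 1]].

(* The map T : A -> A^*, with <x, T(y)> = T(x, y). *)
Definition biscalar_map (T : {biscalar A}) : A -> (A -> R[i]) :=
  fun y x => T x y.

(* The transpose a^t : (K_c)^* -> A^*, where (K_c)^* = conjugate K. The values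
   are plain functions; they are linear, and bounded when a is. *)
Definition transpose (K : hilbertType R) (a : A -> K) :
    conjugate K -> (A -> R[i]) :=
  fun eta x => inner eta (bar (a x)).

End WhNorm.

(* Main.v *)
Require Import Defs.
From HB Require Import structures.
From mathcomp Require Import all_boot all_order all_algebra sesquilinear.
From mathcomp Require Import all_classical all_reals all_analysis.
From mathcomp Require Import complex ring lra.

Set Implicit Arguments.
Unset Strict Implicit.
Unset Printing Implicit Defensive.

Import Order.TTheory GRing.Theory Num.Theory.
Import numFieldNormedType.Exports.

Local Open Scope classical_set_scope.
Local Open Scope ring_scope.

(** The four conditions are linked as follows.

    (1) => state.  For x_i, y_i in A, condition (1) says that twice the real
    part of sum T(x_i, y_i) is at most the largest value of the quadratic form
    of sum (x_i^* x_i + y_i^* y_i) on unit vectors.  Hence adding this convex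
    cone of constraints to the supremum of the numerical range of an operator
    gives a functional on B(H) that is still sublinear, and the Hahn-Banach
    theorem produces a linear p below it: a state p of the unital algebra B(H)
    with 2 Re T(x, y) <= p(x^* x) + p(y^* y).  Replacing x by its multiples
    gives |T(x, y)|^2 <= p(x^* x) p(y^* y) ([dominating_state]).

    (1) => (2).  Restrict p to C*(A) and divide by the norm of the restriction,
    which is at most 1.  If the restriction vanishes then so does T, and any
    vector state not vanishing on C*(A) will do ([whdual_state]).

    (1) => (3).  Apply the Gelfand-Naimark-Segal construction to p on B(H),
    where the identity gives a cyclic unit vector xi at once; working with the
    non-unital algebra C*(A) would need an approximate unit to find xi.  In the
    variables pi(x) xi and pi(y) xi, T is a contractive bilinear form on a
    subspace of K, and two applications of the Riesz theorem extend it to a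
    contraction b from K to its conjugate ([whdual_representation]).

    (2) => (1) is the arithmetic-geometric mean inequality together with
    p0(sum z_i^* z_i) <= |sum z_i^* z_i| ([state_whdual]), so that (2) => (3).

    (3) => (4).  Take a(x) = pi(x) xi.  Since K carries the column structure,
    complete contractivity of a reduces to
    sum |pi(z_i) xi|^2 <= |sum z_i^* z_i| for columns z, that is to the
    contractivity of pi on C*(A).  The latter is proved without spectral theory:
    if pi increased a norm, a Neumann series in C*(A) would make an operator
    bounded below that has approximate null vectors
    ([star_rep_contractive]).

    (4) => (1).  A column is a square matrix with zero columns added, so the
    completely bounded norm of a controls columns, and (1) follows as from (2)
    ([factorization_whdual]).

    Hilbert space completions, the Riesz theorem and the Hahn-Banach theorem are
    proved on the way.  The completion is realised inside the dual: the squared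
    dual norm, written as the Legendre transform of the quadratic form, yields
    density and the inner product by completing the square.  The Hahn-Banach
    theorem comes from the fact that minimal sublinear functionals are
    linear. *)

(** * Complex scalars, real-valued norms and inner products *)

Section ComplexScalars.
Variable R : realType.
Implicit Types (z w : R[i]) (t : R).

Lemma ReD z w : complex.Re (z + w) = complex.Re z + complex.Re w.
Proof. by case: z; case: w. Qed.

Lemma ReN z : complex.Re (- z) = - complex.Re z.
Proof. by case: z. Qed.

Lemma ReB z w : complex.Re (z - w) = complex.Re z - complex.Re w.
Proof. by rewrite ReD ReN. Qed.

Lemma ReZ t z : complex.Re (t%:C%C * z) = t * complex.Re z.
Proof. by case: z => a b /=; rewrite mul0r subr0. Qed.

Lemma Re_conj z : complex.Re z^* = complex.Re z.
Proof. by case: z. Qed.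

Lemma Re_sum I (s : seq I) (F : I -> R[i]) :
  complex.Re (\sum_(i <- s) F i) = \sum_(i <- s) complex.Re (F i).
Proof. by apply: (big_morph _ ReD). Qed.

Lemma Re_mulI z : complex.Re ('i%C * z) = - complex.Im z.
Proof. by case: z => a b /=; rewrite mul0r mul1r sub0r. Qed.

Lemma eqC_ReIm z w :
  complex.Re z = complex.Re w -> complex.Im z = complex.Im w -> z = w.
Proof. by case: z => a b; case: w => c d /= -> ->. Qed.

Lemma conj_realC t : (t%:C%C : R[i])^* = t%:C%C.
Proof. exact: conjc_real. Qed.

Lemma rnorm_realC t : rnorm (t%:C%C : R[i]) = `|t|.
Proof. by rewrite /rnorm normc_def /= expr0n /= addr0 sqrtr_sqr. Qed.

Lemma rnorm1 : rnorm (1 : R[i]) = 1.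
Proof. by rewrite /rnorm normr1. Qed.

Lemma rnorm_i : rnorm ('i%C : R[i]) = 1.
Proof. by rewrite /rnorm normc_def /= expr0n expr1n /= add0r sqrtr1. Qed.

Lemma rnormM z w : rnorm (z * w) = rnorm z * rnorm w.
Proof. by rewrite /rnorm normrM (rnormE z) (rnormE w) -rmorphM. Qed.

Lemma rnorm_conj z : rnorm z^* = rnorm z.
Proof. by rewrite /rnorm norm_conjC. Qed.

Lemma mulc_conj z : z * z^* = (rnorm z ^+ 2)%:C%C.
Proof. by rewrite -normCK (rnormE z) rmorphXn. Qed.

Lemma Re_le_rnorm z : complex.Re z <= rnorm z.
Proof.
rewrite /rnorm normc_def /=; apply: (le_trans (ler_norm _)).
by rewrite -sqrtr_sqr ler_wsqrtr// lerDl sqr_ge0.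
Qed.

Lemma ge0_complexE z : 0 <= z -> z = (complex.Re z)%:C%C.
Proof. by move=> z0; rewrite RRe_real// ger0_real. Qed.

Lemma ge0_Re z : 0 <= z -> 0 <= complex.Re z.
Proof. by move=> z0; rewrite -lecR -ge0_complexE. Qed.

(** Optimising over the complex multiple turns a family of affine bounds into
    a Cauchy-Schwarz inequality; every inequality of that kind below comes
    from here. *)
Lemma quadratic_bound z (A B : R) : 0 <= A ->
  (forall a : R[i], 2 * complex.Re (a * z) <= rnorm a ^+ 2 * A + B) ->
  rnorm z ^+ 2 <= A * B.
Proof.
move=> A0 zAB; have zz (r : R) :
    2 * (r * rnorm z ^+ 2) <= r ^+ 2 * rnorm z ^+ 2 * A + B.
  have := zAB (r%:C%C * z^*).
  rewrite -mulrA (mulrC z^*) mulc_conj ReZ rnormM rnorm_conj rnorm_realC.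
  by rewrite exprMn real_normK ?num_real.
have := sqr_ge0 (rnorm z); move: (rnorm z ^+ 2) zz => n zz n0.
have [A1|A1] := eqVneq A 0.
  rewrite A1 mul0r leNgt; apply/negP => n1.
  have := zz ((`|B| + 1) / n); rewrite A1 mulr0 add0r divfK ?gt_eqF//.
  have := ler_norm B; have := normr_ge0 B; lra.
have Agt : 0 < A by rewrite lt_def A1.
have := zz A^-1; rewrite -(ler_pM2l Agt) mulrDr.
have -> : A * (A^-1 ^+ 2 * n * A) = n by field.
have -> : A * (2 * (A^-1 * n)) = 2 * n by field.
lra.
Qed.

End ComplexScalars.

Section RealNorm.
Variables (R : realType) (V : normedZmodType R[i]).
Implicit Types x y : V.

Lemma ler_rnormD x y : rnorm (x + y) <= rnorm x + rnorm y.
Proof. by rewrite -lecR rmorphD /= -!rnormE ler_normD. Qed.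

Lemma rnorm0 : rnorm (0 : V) = 0.
Proof. by rewrite /rnorm normr0. Qed.

Lemma rnormN x : rnorm (- x) = rnorm x.
Proof. by rewrite /rnorm normrN. Qed.

Lemma rnormB x y : rnorm (x - y) = rnorm (y - x).
Proof. by rewrite -rnormN opprB. Qed.

Lemma rnorm_eq0 x : (rnorm x == 0) = (x == 0).
Proof.
by rewrite -[RHS]normr_eq0 (rnormE x) -(inj_eq (@complexI R)).
Qed.

Lemma rnorm_gt0 x : (0 < rnorm x) = (x != 0).
Proof. by rewrite lt_def rnorm_ge0 andbT rnorm_eq0. Qed.

Lemma ler_rdistD z x y : rnorm (x - y) <= rnorm (x - z) + rnorm (z - y).
Proof. by have := ler_rnormD (x - z) (z - y); rewrite addrA subrK. Qed.

Lemma ler_rnorm_sum I (s : seq I) (F : I -> V) :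
  rnorm (\sum_(i <- s) F i) <= \sum_(i <- s) rnorm (F i).
Proof.
elim: s => [|i s IH]; first by rewrite !big_nil rnorm0.
by rewrite !big_cons (le_trans (ler_rnormD _ _))// lerD2l.
Qed.

Lemma le_rnorm_eq0 x : (forall e : R, 0 < e -> rnorm x <= e) -> x = 0.
Proof.
move=> xe; apply/eqP; rewrite -rnorm_eq0 eq_le rnorm_ge0 andbT.
by apply/ler_addgt0Pl => e e0; rewrite addr0 xe.
Qed.

End RealNorm.

Lemma rnormZ (R : realType) (V : normedModType R[i]) (a : R[i]) (x : V) :
  rnorm (a *: x) = rnorm a * rnorm x.
Proof. by rewrite /rnorm normrZ (rnormE a) (rnormE x) -rmorphM. Qed.

Lemma rnorm_normalize (R : realType) (V : normedModType R[i]) (x : V) :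
  x != 0 -> rnorm ((rnorm x)^-1%:C%C *: x) = 1.
Proof.
move=> x0; rewrite rnormZ rnorm_realC ger0_norm ?invr_ge0 ?rnorm_ge0//.
by rewrite mulVf// rnorm_eq0.
Qed.

Section InnerProduct.
Variables (R : realType) (H : hilbertType R).
Implicit Types (u v w : H) (a : R[i]).

Lemma innerDl u v w : inner (u + v) w = inner u w + inner v w.
Proof. by have := linearPl (inner : {dot H for _}) w 1 u v;
  rewrite scale1r mul1r. Qed.

Lemma innerDr u v w : inner u (v + w) = inner u v + inner u w.
Proof.
have := linearPr (inner : {dot H for _}) u 1 v w.
by rewrite scale1r /= rmorph1 mul1r.
Qed.

Lemma inner0l v : inner (0 : H) v = 0.
Proof. exact: (linear0l (inner : {dot H for _})). Qed.

Lemma inner0r v : inner v (0 : H) = 0.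
Proof. exact: (linear0r (inner : {dot H for _})). Qed.

Lemma innerZl a u v : inner (a *: u) v = a * inner u v.
Proof. exact: (linearZl_LR (inner : {dot H for _})). Qed.

Lemma innerZr a u v : inner u (a *: v) = a^* * inner u v.
Proof. exact: (linearZr_LR (inner : {dot H for _})). Qed.

Lemma innerC u v : inner u v = (inner v u)^*.
Proof.
have := @hermitian_subproof _ H false _ (inner : {dot H for _}) u v.
by rewrite expr0 mul1r.
Qed.

Lemma innerNl u v : inner (- u) v = - inner u v.
Proof. by rewrite -scaleN1r innerZl mulN1r. Qed.

Lemma innerNr u v : inner u (- v) = - inner u v.
Proof. by rewrite -scaleN1r innerZr rmorphN rmorph1 mulN1r. Qed.

Lemma innerBl u v w : inner (u - v) w = inner u w - inner v w.
Proof. by rewrite innerDl innerNl. Qed.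

Lemma innerBr u v w : inner u (v - w) = inner u v - inner u w.
Proof. by rewrite innerDr innerNr. Qed.

Lemma inner_sumr I (s : seq I) u (F : I -> H) :
  inner u (\sum_(i <- s) F i) = \sum_(i <- s) inner u (F i).
Proof. by apply: (big_morph _ (innerDr u) (inner0r u)). Qed.

Lemma inner_self u : inner u u = (rnorm u ^+ 2)%:C%C.
Proof. by rewrite inner_norm (rnormE u) rmorphXn. Qed.

Lemma Re_innerC u v : complex.Re (inner u v) = complex.Re (inner v u).
Proof. by rewrite innerC Re_conj. Qed.

Lemma sqr_rnormD u v : rnorm (u + v) ^+ 2 =
  rnorm u ^+ 2 + 2 * complex.Re (inner u v) + rnorm v ^+ 2.
Proof.
have Re_self w : rnorm w ^+ 2 = complex.Re (inner w w) by rewrite inner_self.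
rewrite !Re_self innerDl !innerDr !ReD (Re_innerC v u); ring.
Qed.

Lemma sqr_rnormB u v : rnorm (u - v) ^+ 2 =
  rnorm u ^+ 2 - 2 * complex.Re (inner u v) + rnorm v ^+ 2.
Proof. by rewrite sqr_rnormD rnormN innerNr ReN mulrN. Qed.

Lemma Cauchy_Schwarz u v : rnorm (inner u v) <= rnorm u * rnorm v.
Proof.
rewrite -(@ler_pXn2r _ 2%N) ?nnegrE ?mulr_ge0 ?rnorm_ge0// exprMn.
apply: quadratic_bound => [|a]; first by rewrite sqr_ge0.
have := sqr_ge0 (rnorm (a *: u - v)).
rewrite sqr_rnormB rnormZ exprMn innerZl; lra.
Qed.

Lemma inner_ext u v : (forall w, inner w u = inner w v) -> u = v.
Proof.
move=> uv; apply/eqP; rewrite -subr_eq0 -rnorm_eq0 -sqrf_eq0.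
by rewrite -(inj_eq (@complexI R)) -inner_self innerBr uv subrr.
Qed.

End InnerProduct.

Lemma ex_linear (R : pzRingType) (U V : lmodType R) (f : U -> V) :
  linear f -> exists g : {linear U -> V}, forall x, g x = f x.
Proof.
move=> lf; pose g : {linear U -> V} := HB.pack f (GRing.isLinear.Build _ _ _ _
  f lf).
by exists g.
Qed.

Lemma ex_scalar (R : pzRingType) (U : lmodType R) (f : U -> R) :
  scalar f -> exists g : {scalar U}, forall x, g x = f x.
Proof.
move=> lf; pose g : {scalar U} := HB.pack f (GRing.isLinear.Build _ _ _ _ f lf).
by exists g.
Qed.

(** * Limits and the Riesz representation *)

Lemma le_small (R : realType) (x y C : R) : 0 <= C ->
  (forall e, 0 < e <= 1 -> x <= y + e * C) -> x <= y.
Proof.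
move=> C0 xy; apply/ler_addgt0Pr => e e0.
have C1 : 0 < C + 1 by rewrite ltr_wpDl.
pose d := Num.min 1 (e / (C + 1)).
have d0 : 0 < d by rewrite lt_min ltr01 divr_gt0.
have de : d * (C + 1) <= e by rewrite -ler_pdivlMr// ge_min lexx orbT.
have := xy d; rewrite d0 ge_min lexx /= => /(_ isT).
lra.
Qed.

Lemma ball_rnormP (R : realType) (V : normedModType R[i]) (x y : V) (r : R) :
  ball x r%:C%C y <-> rnorm (x - y) < r.
Proof. by rewrite -ball_normE /ball_ /= rnormE ltcR. Qed.

(** A family indexed by any type whose pairwise distances are controlled by
    the sum of two errors has a limit, and each member is within its own error
    of it.  Keeping the errors in the statement means that no sequence has to
    be extracted when the family is the set of near-maximisers of a
    functional. *)
Lemma family_limit (R : realType) (K : hilbertType R) I (u : I -> K)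
    (e : I -> R) :
  (forall i j, rnorm (u i - u j) <= e i + e j) ->
  (forall d, 0 < d -> exists i, e i < d) ->
  exists l, forall i, rnorm (u i - l) <= e i.
Proof.
move=> ue e0.
pose B (d : R) : set K := [set u i | i in [set i | e i < d]].
have FF : ProperFilter (filter_from [set d : R | 0 < d] B).
  apply: filter_from_proper => [|d /= d0]; last first.
    by have [i ei] := e0 d d0; exists (u i), i.
  apply: filter_from_filter; first by exists 1 => /=.
  move=> d d' /= d0 d0'; exists (Num.min d d'); first by rewrite /= lt_min d0.
  by move=> _ [i /= + <-]; rewrite lt_min => /andP[? ?]; split; exists i.
have : cvg (filter_from [set d : R | 0 < d] B).
  apply/cauchy_cvgP/cauchy_exP => eps eps0.
  have epsR : eps = (complex.Re eps)%:C%C by rewrite -ge0_complexE// ltW.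
  have d0 : 0 < complex.Re eps / 2 by rewrite divr_gt0// -ltcR -epsR.
  have [i ei] := e0 _ d0; exists (u i), (complex.Re eps / 2) => //.
  move=> _ [j /= ej <-]; rewrite epsR; apply/ball_rnormP.
  by apply: le_lt_trans (ue i j) _; lra.
move=> /cvg_ex[l Fl]; exists l => i; apply/ler_addgt0Pr => d d0.
have d20 : 0 < d / 2 by rewrite divr_gt0.
have : filter_from [set d : R | 0 < d] B (ball l (d / 2)%:C%C).
  by apply: Fl; apply: nbhsx_ballx; rewrite ltcR.
move=> [r r0 /= Br]; have [j] := e0 (Num.min r (d / 2)) ltac:(by rewrite lt_min
  r0).
rewrite lt_min => /andP[jr jd].
have /ball_rnormP : ball l (d / 2)%:C%C (u j) by apply: Br; exists j.
rewrite rnormB => lj.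
have := ler_rdistD (u j) (u i) l; have := ue i j; lra.
Qed.

(** The supremum of the lower ends a i - e i is a common point of the intervals
    of centre a i and radius e i. *)
Lemma real_family_limit (R : realType) I (i0 : I) (a e : I -> R) :
  (forall i j, `|a i - a j| <= e i + e j) ->
  exists s, forall i, `|a i - s| <= e i.
Proof.
move=> ae; pose E := range (fun i => a i - e i).
have ub i j : a i - e i <= a j + e j by have := ae i j; rewrite ler_norml; lra.
have hE : has_sup E.
  by split; [exists (a i0 - e i0), i0 | exists (a i0 + e i0) => _ [i _ <-]].
exists (sup E) => i; rewrite ler_distlC; apply/andP; split.
  by apply: sup_upper_bound => //; exists i.
by apply: ge_sup => [|_ [j _ <-]]; [have [] := hE | exact: ub].
Qed.

Lemma complex_family_limit (R : realType) I (i0 : I) (a : I -> R[i])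
    (e : I -> R) :
  (forall i j, rnorm (a i - a j) <= e i + e j) ->
  exists s, forall i, rnorm (a i - s) <= 2 * e i.
Proof.
move=> ae.
have [|s as_] := @real_family_limit R I i0 (fun i => complex.Re (a i)) e.
  move=> i j; apply: le_trans (ae i j); rewrite -ReB.
  by rewrite -lecR -rnormE normc_ge_Re.
have [|t at_] := @real_family_limit R I i0 (fun i => complex.Im (a i)) e.
  move=> i j; apply: le_trans (ae i j).
  have -> : complex.Im (a i) - complex.Im (a j) =
      - complex.Re ('i%C * (a i - a j)).
    by rewrite Re_mulI; case: (a i) => ? ?; case: (a j) => ? ? /=;
      rewrite opprK.
  rewrite normrN -[leRHS]mul1r -[X in _ <= X * _](rnorm_i R) -rnormM.
  by rewrite -lecR -rnormE normc_ge_Re.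
exists (s +i* t)%C => i.
have -> : a i - (s +i* t)%C = (complex.Re (a i) - s)%:C%C +
    'i%C * (complex.Im (a i) - t)%:C%C.
  by rewrite [LHS]complexE; case: (a i).
rewrite (le_trans (ler_rnormD _ _))// rnormM rnorm_i mul1r !rnorm_realC.
have := as_ i; have := at_ i; lra.
Qed.

Section Riesz.
Variables (R : realType) (V : lmodType R[i]) (K : hilbertType R).
Variable j : {linear V -> K}.
Implicit Types (phi psi : V -> R[i]) (d k : K).

(** The second clause places d in the closure of the range of j, written as
    its double orthogonal complement, and makes d unique. *)
Definition represents phi d :=
  (forall x, phi x = inner (j x) d) /\
  (forall k, (forall x, inner (j x) k = 0) -> inner d k = 0).

Definition riesz phi : K := xget 0 [set d | represents phi d].

Lemma represents_uniq phi d d' :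
  represents phi d -> represents phi d' -> d = d'.
Proof.
move=> [pd od] [pd' od']; apply/eqP; rewrite -subr_eq0 -rnorm_eq0 -sqrf_eq0.
have dd x : inner (j x) (d - d') = 0 by rewrite innerBr -pd -pd' subrr.
rewrite -(inj_eq (@complexI R)) -inner_self innerBl.
by rewrite od// od'// subrr.
Qed.

Lemma represents_lin phi psi d d' (a : R[i]) :
  represents phi d -> represents psi d' ->
  represents (fun x => a * phi x + psi x) (a^* *: d + d').
Proof.
move=> [pd od] [pd' od']; split=> [x|k jk].
  by rewrite innerDr innerZr conjCK pd pd'.
by rewrite innerDl innerZl od// od'// mulr0 addr0.
Qed.

(** The functional x |-> 2 Re (phi x) - |j x|^2 is strictly concave in j x, so
    by the parallelogram law its near-maximisers cluster; the vector they
    converge to represents phi. *)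
Lemma riesz_exists phi (M : R) : 0 <= M -> scalar phi ->
  (forall x, rnorm (phi x) <= M * rnorm (j x)) ->
  exists2 d, represents phi d & rnorm d <= M.
Proof.
move=> M0 lphi phiM.
have phiD x y : phi (x + y) = phi x + phi y.
  by have := lphi 1 x y; rewrite scale1r mul1r.
have phi0 : phi 0 = 0 by have := phiD 0 0;
  rewrite addr0 => /(canLR (addrK _)) <-; rewrite subrr.
have phiZ a x : phi (a *: x) = a * phi x.
  by have := lphi a x 0; rewrite !addr0 phi0 addr0.
have jDZ x y a : j (x + a *: y) = j x + a *: j y by rewrite linearD linearZ.
have jZ x a : j (a *: x) = a *: j x by rewrite linearZ.
pose F x := 2 * complex.Re (phi x) - rnorm (j x) ^+ 2.
pose S := sup (range F).
have F_M x : F x <= M ^+ 2.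
  have := Re_le_rnorm (phi x); have := phiM x;
    have := sqr_ge0 (M - rnorm (j x)).
  rewrite /F; lra.
have supF : has_sup (range F).
  by split; [exists (F 0), 0 | exists (M ^+ 2) => _ [x _ <-]].
have F_S x : F x <= S by apply: sup_upper_bound => //; exists x.
(* The error attached to x measures how far x is from maximising F. *)
pose e x : R := Num.sqrt (2 * (S - F x)).
have e_sqr x : e x ^+ 2 = 2 * (S - F x).
  by rewrite sqr_sqrtr// mulr_ge0// subr_ge0.
have e_ge0 x : 0 <= e x by rewrite sqrtr_ge0.
have F_add x y a : F (x + a *: y) = F x + 2 * complex.Re (a * phi y) -
    2 * complex.Re (a * inner (j y) (j x)) - rnorm a ^+ 2 * rnorm (j y) ^+ 2.
  rewrite /F phiD phiZ jDZ sqr_rnormD rnormZ exprMn Re_innerC.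
  by rewrite innerZl ReD; ring.
have e_dist x y : rnorm (j x - j y) <= e x + e y.
  rewrite -(@ler_pXn2r _ 2%N) ?nnegrE ?addr_ge0 ?rnorm_ge0//.
  suff : rnorm (j x - j y) ^+ 2 <= e x ^+ 2 + e y ^+ 2.
    by move/le_trans; apply; have := mulr_ge0 (e_ge0 x) (e_ge0 y); lra.
  have := F_S (2^-1%:C%C *: x + 2^-1%:C%C *: y); rewrite !e_sqr sqr_rnormB.
  rewrite F_add /F phiZ jZ innerZr !rnormZ !rnorm_realC.
  rewrite conj_realC !ReZ (Re_innerC (j y)) ger0_norm//.
  rewrite !exprMn; lra.
have e_small r : 0 < r -> exists x, e x < r.
  move=> r0; have r20 : 0 < r ^+ 2 / 2 by rewrite divr_gt0// exprn_gt0.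
  have [_ [x _ <-] Sx] := sup_adherent r20 supF.
  exists x; rewrite -(@ltr_pXn2r _ 2%N) ?nnegrE// ?(ltW r0)// e_sqr.
  by rewrite -/S in Sx; lra.
have [d jd] := family_limit e_dist e_small.
have pd z : phi z = inner (j z) d.
  apply/eqP; rewrite -subr_eq0 -rnorm_eq0 -sqrf_eq0.
  rewrite eq_le sqr_ge0 andbT -[leRHS](mulr0 (rnorm (j z) ^+ 2)).
  apply: quadratic_bound => [|a]; first exact: sqr_ge0.
  rewrite addr0; apply: (@le_small _ _ _ (2 * rnorm a * rnorm (j z) + 1)).
    by rewrite addr_ge0// !mulr_ge0 ?rnorm_ge0.
  move=> r /andP[r0 r1]; have [x xr] := e_small r r0.
  have := F_S (x + a *: z); rewrite F_add.
  have : complex.Re (a * inner (j z) (j x)) - complex.Re (a * inner (j z) d) <=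
      rnorm a * rnorm (j z) * r.
    rewrite -ReB -mulrBr -innerBr (le_trans (Re_le_rnorm _))// rnormM -mulrA.
    rewrite ler_wpM2l ?rnorm_ge0// (le_trans (Cauchy_Schwarz _ _))//.
    by rewrite ler_wpM2l ?rnorm_ge0// (le_trans (jd x))// ltW.
  have : e x ^+ 2 <= r by have := e_ge0 x; nra.
  rewrite mulrBr ReB e_sqr; lra.
exists d; first split; first exact: pd.
- move=> k jk; apply: le_rnorm_eq0 => r r0.
  apply: (@le_small _ _ _ (rnorm k)); first exact: rnorm_ge0.
  move=> s /andP[s0 _]; have [x xs] := e_small s s0.
  have -> : inner d k = inner (d - j x) k by rewrite innerBl jk subr0.
  rewrite (le_trans (Cauchy_Schwarz _ _))// ler_wpDl ?(ltW r0)//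
    ler_wpM2r ?rnorm_ge0//.
  by rewrite rnormB (le_trans (jd x))// ltW.
- have [->|d_neq0] := eqVneq d 0; first by rewrite rnorm0.
  have d0 : 0 < rnorm d by rewrite rnorm_gt0 d_neq0.
  rewrite -(ler_pM2r d0); apply: (@le_small _ _ _ (rnorm d + M)).
    by rewrite addr_ge0// ltW.
  move=> s /andP[s0 _]; have [x xs] := e_small s s0.
  suff : complex.Re (inner (j x) d) <= M * (rnorm d + s).
    have : complex.Re (inner (d - j x) d) <= s * rnorm d.
      rewrite (le_trans (Re_le_rnorm _))// (le_trans (Cauchy_Schwarz _ _))//.
      by rewrite ler_wpM2r ?rnorm_ge0// rnormB (le_trans (jd x))// ltW.
    rewrite innerBl inner_self ReB /=; lra.
  rewrite -pd (le_trans (Re_le_rnorm _))// (le_trans (phiM x))//.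
  rewrite ler_wpM2l//.
  have := ler_rnormD d (j x - d); rewrite addrC subrK => /le_trans; apply.
  by rewrite lerD2l (le_trans (jd x))// ltW.
Qed.

Lemma riesz_uniq phi d : represents phi d -> riesz phi = d.
Proof.
by move=> pd; apply/(@represents_uniq phi) => //;
  exact: (xgetPex 0 (ex_intro _ d pd)).
Qed.

Lemma rieszP phi (M : R) : 0 <= M -> scalar phi ->
  (forall x, rnorm (phi x) <= M * rnorm (j x)) -> represents phi (riesz phi).
Proof.
by move=> M0 lphi phiM; have [d pd _] := riesz_exists M0 lphi phiM;
  rewrite (riesz_uniq pd).
Qed.

Lemma rnorm_riesz phi (M : R) : 0 <= M -> scalar phi ->
  (forall x, rnorm (phi x) <= M * rnorm (j x)) -> rnorm (riesz phi) <= M.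
Proof.
by move=> M0 lphi phiM; have [d pd dM] := riesz_exists M0 lphi phiM;
  rewrite (riesz_uniq pd).
Qed.

End Riesz.

(** * Bounded operators and their adjoints *)

Section BoundedOperatorTheory.
Variables (R : realType) (U V : normedModType R[i]).

Lemma bop_ext (f g : bop U V) : (forall x, f x = g x) -> f = g.
Proof. by move=> fg; apply/val_inj/funext => x; exact: fg. Qed.

Lemma bounded_linearP (f : U -> V) (M : R) : linear f ->
  (forall x, rnorm (f x) <= M * rnorm x) -> f \in @bounded_linear R U V.
Proof. by move=> lf fM; apply/asboolP; split=> //; exists M. Qed.

Lemma bopD (f g : bop U V) x : (f + g) x = f x + g x. Proof. by []. Qed.
Lemma bopZ a (f : bop U V) x : (a *: f) x = a *: f x. Proof. by []. Qed.
Lemma bopN (f : bop U V) x : (- f) x = - f x. Proof. by []. Qed.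
Lemma bopB (f g : bop U V) x : (f - g) x = f x - g x. Proof. by []. Qed.

Lemma bop_sum I (s : seq I) (F : I -> bop U V) x :
  (\sum_(i <- s) F i) x = \sum_(i <- s) F i x.
Proof.
by elim: s => [|i s IH]; rewrite ?big_nil// !big_cons bopD IH.
Qed.

Lemma opnorm_ub (f : bop U V) x : rnorm x <= 1 -> rnorm (f x) <= opnorm f.
Proof.
move=> x1; have /asboolP[_ [M fM]] := valP f.
apply: sup_upper_bound; last by exists x.
split; first by exists (rnorm (f 0)), 0 => //=; rewrite rnorm0.
exists `|M| => _ [y /= y1 <-]; apply: (le_trans (fM y)).
have := rnorm_ge0 y; have := ler_norm M; have := normr_ge0 M; nra.
Qed.

Lemma opnorm_ge0 (f : bop U V) : 0 <= opnorm f.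
Proof.
by apply: (le_trans (rnorm_ge0 (f 0))); apply: opnorm_ub; rewrite rnorm0.
Qed.

Lemma le_opnorm (f : bop U V) x : rnorm (f x) <= opnorm f * rnorm x.
Proof.
have [->|x0] := eqVneq x 0; first by rewrite linear0 !rnorm0 mulr0.
have nx : 0 < rnorm x by rewrite rnorm_gt0 x0.
have := @opnorm_ub f ((rnorm x)^-1%:C%C *: x).
rewrite rnorm_normalize// linearZ rnormZ rnorm_realC => /(_ (lexx _)).
by rewrite ger0_norm ?invr_ge0 ?(ltW nx)// mulrC ler_pdivrMr.
Qed.

Lemma opnorm_le (f : bop U V) (M : R) : 0 <= M ->
  (forall x, rnorm (f x) <= M * rnorm x) -> opnorm f <= M.
Proof.
move=> M0 fM; apply: ge_sup => [|_ [x /= x1 <-]].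
  by exists (rnorm (f 0)), 0 => //=; rewrite rnorm0.
by apply: (le_trans (fM x)); rewrite ler_piMr.
Qed.

End BoundedOperatorTheory.

Section Adjoints.
Variables (R : realType) (H : hilbertType R).
Implicit Types x y z : 'B(H).

Lemma opid_bounded : @idfun H \in @bounded_linear R H H.
Proof. by apply: (@bounded_linearP _ _ _ _ 1) => // u; rewrite mul1r. Qed.

Definition opid : 'B(H) := Bop opid_bounded.

(** The default value in the definition of the adjoint is not taken, by the
    Riesz theorem on H itself. *)
Lemma opadjP x u v : inner (x u) v = inner u (opadj x v).
Proof.
rewrite /opadj; case: xgetP => [z _ xz|no_adj]; first exact: xz.
pose phi w : H -> R[i] := fun u => inner (x u) w.
have lphi w : scalar (phi w).
  by move=> a y z; rewrite /phi linearD linearZ innerDl innerZl.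
have phiM w (y : H) : rnorm (phi w y) <= opnorm x * rnorm w * rnorm y.
  rewrite (le_trans (Cauchy_Schwarz _ _))// mulrAC.
  by rewrite ler_wpM2r ?rnorm_ge0 ?le_opnorm.
have nn (w : H) : 0 <= opnorm x * rnorm w
  by rewrite mulr_ge0 ?opnorm_ge0 ?rnorm_ge0.
pose z w : H := riesz (@idfun H) (phi w).
have zP w (y : H) : inner (x y) w = inner y (z w).
  by have [<- _] := rieszP (j := idfun) (nn w) (lphi w) (phiM w).
have z_lin : linear z.
  move=> a w w'; apply: inner_ext => y.
  by rewrite innerDr innerZr -!zP innerDr innerZr.
have z_bd : z \in @bounded_linear R H H.
  apply: (@bounded_linearP _ _ _ _ (opnorm x)) => // w.
  exact: (rnorm_riesz (j := idfun) (nn w) (lphi w) (phiM w)).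
by case: (no_adj (Bop z_bd)) => y w; exact: zP.
Qed.

Lemma opadjPr x u v : inner u (x v) = inner (opadj x u) v.
Proof. by rewrite innerC opadjP -innerC. Qed.

Lemma opadj_uniq x z : is_adjoint x z -> opadj x = z.
Proof.
by move=> xz; apply: bop_ext => v; apply: inner_ext => u; rewrite -opadjP xz.
Qed.

Lemma opadjK x : opadj (opadj x) = x.
Proof. by apply: opadj_uniq => u v; rewrite -opadjPr. Qed.

Lemma opadj_id : opadj opid = opid.
Proof. exact: opadj_uniq. Qed.

Lemma opadj_lin (a : R[i]) x y : opadj (a *: x + y) = a^* *: opadj x + opadj y.
Proof.
apply: opadj_uniq => u v; rewrite !bopD !bopZ innerDl innerDr innerZl innerZr.
by rewrite conjCK !opadjP.
Qed.

Lemma opadjM x y : opadj (opmul x y) = opmul (opadj y) (opadj x).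
Proof. by apply: opadj_uniq => u v /=; rewrite !opadjP. Qed.

Lemma opmul_linr x a y z : opmul x (a *: y + z) = a *: opmul x y + opmul x z.
Proof. by apply: bop_ext => u /=; rewrite linearD linearZ. Qed.

Lemma opmul_linl x a y z : opmul (a *: y + z) x = a *: opmul y x + opmul z x.
Proof. exact: bop_ext. Qed.

Lemma opadjZ (a : R[i]) x : opadj (a *: x) = a^* *: opadj x.
Proof.
apply: opadj_uniq => u v; rewrite !bopZ innerZl innerZr.
by rewrite conjCK opadjP.
Qed.

Lemma opmul_adjZ (a : R[i]) x : opmul (opadj (a *: x)) (a *: x) =
  (rnorm a ^+ 2)%:C%C *: opmul (opadj x) x.
Proof.
rewrite opadjZ; apply: bop_ext => v.
have -> : opmul (a^* *: opadj x) (a *: x) v = a^* *: opadj x (a *: x v) by [].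
by rewrite linearZ scalerA mulrC mulc_conj.
Qed.

Lemma opmulA x y z : opmul x (opmul y z) = opmul (opmul x y) z.
Proof. exact: bop_ext. Qed.

Lemma inner_adjmul x v :
  inner (opmul (opadj x) x v) v = (rnorm (x v) ^+ 2)%:C%C.
Proof. by rewrite /= -opadjPr inner_self. Qed.

End Adjoints.

(** * Hilbert space completion of a positive semidefinite form *)

Record psd_form (R : realType) (V : lmodType R[i]) := PsdForm {
  psd_fun :> V -> V -> R[i];
  psd_linearl : forall y, scalar (psd_fun^~ y);
  psd_herm : forall x y, psd_fun x y = (psd_fun y x)^*;
  psd_ge0 : forall x, 0 <= complex.Re (psd_fun x x)
}.

Section PsdForm.
Variables (R : realType) (V : lmodType R[i]) (h : psd_form V).
Implicit Types x y : V.

Definition psd_sqr x : R := complex.Re (h x x).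
Definition psd_norm x : R := Num.sqrt (psd_sqr x).

Lemma psd_norm_ge0 x : 0 <= psd_norm x. Proof. exact: sqrtr_ge0. Qed.

Lemma sqr_psd_norm x : psd_norm x ^+ 2 = psd_sqr x.
Proof. by rewrite sqr_sqrtr// psd_ge0. Qed.

Lemma psdDl x x' y : h (x + x') y = h x y + h x' y.
Proof. by have := psd_linearl h y 1 x x'; rewrite /= scale1r mul1r. Qed.

Lemma psd0l y : h 0 y = 0.
Proof. by have := psdDl 0 0 y; rewrite addr0 => /(canLR (addrK _)) <-;
  rewrite subrr. Qed.

Lemma psdZl a x y : h (a *: x) y = a * h x y.
Proof. by have := psd_linearl h y a x 0; rewrite /= !addr0 psd0l addr0. Qed.

Lemma psdDr x y y' : h x (y + y') = h x y + h x y'.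
Proof. by rewrite psd_herm psdDl rmorphD /= -!psd_herm. Qed.

Lemma psdZr a x y : h x (a *: y) = a^* * h x y.
Proof. by rewrite psd_herm psdZl rmorphM /= -psd_herm. Qed.

Lemma Re_psdC x y : complex.Re (h x y) = complex.Re (h y x).
Proof. by rewrite psd_herm Re_conj. Qed.

Lemma psd_sqrDZ x y a : psd_sqr (x + a *: y) =
  psd_sqr x + 2 * complex.Re (a * h y x) + rnorm a ^+ 2 * psd_sqr y.
Proof.
rewrite /psd_sqr psdDl !psdDr !ReD (Re_psdC x) !psdZl psdZr mulrA mulc_conj ReZ.
ring.
Qed.

Lemma psd_sqrN x : psd_sqr (- x) = psd_sqr x.
Proof. by rewrite -scaleN1r /psd_sqr psdZl psdZr mulrA rmorphN rmorph1 mulrNN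
  !mul1r. Qed.

Lemma psd_Cauchy_Schwarz x y : rnorm (h x y) <= psd_norm x * psd_norm y.
Proof.
rewrite -(@ler_pXn2r _ 2%N) ?nnegrE ?mulr_ge0 ?rnorm_ge0 ?psd_norm_ge0//.
rewrite exprMn !sqr_psd_norm; apply: quadratic_bound => [|a];
  first exact: psd_ge0.
have := psd_ge0 h (- y + a *: x); rewrite -/(psd_sqr _) psd_sqrDZ.
by rewrite psd_sqrN -scaleN1r psdZr rmorphN rmorph1 mulN1r mulrN ReN; lra.
Qed.

End PsdForm.

(** The completion of V is realised as the space of bounded conjugate-linear
    functionals on V, x in V being the functional y |-> h x y; the null
    vectors of h are then identified without a quotient. *)
Section Completion.
Variables (R : realType) (V : lmodType R[i]) (h : psd_form V).

Definition conj_linear (f : V -> R[i]^o) :=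
  forall a x y, f (a *: x + y) = a^* * f x + f y.

Definition bounded_conj_linear : {pred V -> R[i]^o} :=
  [pred f | `[< conj_linear f /\
     exists M : R, forall x, rnorm (f x) <= M * psd_norm h x >]].

Fact bounded_conj_linear_submod : submod_closed bounded_conj_linear.
Proof.
split=> [|a f g].
  apply/asboolP; split=> [b x y|]; first by rewrite /= mulr0 addr0.
  by exists 0 => x; rewrite mul0r rnorm0.
move=> /asboolP[lf [M fM]] /asboolP[lg [N gN]]; apply/asboolP; split.
  move=> b x y.
  suff: a * f (b *: x + y) + g (b *: x + y) =
        b^* * (a * f x + g x) + (a * f y + g y) by [].
  by rewrite lf lg; ring.
exists (rnorm a * M + N) => x.
suff : rnorm (a * f x + g x) <= (rnorm a * M + N) * psd_norm h x by [].
rewrite (le_trans (ler_rnormD _ _))// rnormM mulrDl -mulrA.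
by rewrite lerD// ler_wpM2l ?rnorm_ge0.
Qed.

HB.instance Definition _ := GRing.isSubmodClosed.Build R[i] (V -> R[i]^o)
  bounded_conj_linear bounded_conj_linear_submod.

Record completion : Type :=
  Completion { cfun :> V -> R[i]^o ; _ : cfun \in bounded_conj_linear }.

HB.instance Definition _ := [isSub for cfun].
HB.instance Definition _ := [Choice of completion by <:].
HB.instance Definition _ := [SubChoice_isSubLmodule of completion by <:].

Implicit Types (f g : completion) (x y : V).

Local Notation q := (psd_sqr h).

Lemma cfun_ext f g : (forall x, f x = g x) -> f = g.
Proof. by move=> fg; apply/val_inj/funext => x; exact: fg. Qed.

Lemma cfunP f : conj_linear f. Proof. by have /asboolP[] := valP f. Qed.

Lemma cfun_argD f x y : f (x + y) = f x + f y.
Proof. by have := cfunP f 1 x y; rewrite scale1r rmorph1 mul1r. Qed.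

Lemma cfun0 f : f 0 = 0.
Proof. by have := cfun_argD f 0 0; rewrite addr0 => /(canLR (addrK _)) <-;
  rewrite subrr. Qed.

Lemma cfun_argZ f a x : f (a *: x) = a^* * f x.
Proof. by have := cfunP f a x 0; rewrite !addr0 cfun0 addr0. Qed.

Lemma cfun_argN f x : f (- x) = - f x.
Proof. by rewrite -scaleN1r cfun_argZ rmorphN rmorph1 mulN1r. Qed.

Lemma cfunD f g x : (f + g) x = f x + g x. Proof. by []. Qed.
Lemma cfunN f x : (- f) x = - f x. Proof. by []. Qed.
Lemma cfunZ a f x : (a *: f) x = a * f x. Proof. by []. Qed.

(** The square of the dual norm, as a Legendre transform of the quadratic form
    q.  Translating the variable shows how it changes when a vector of V is
    added, which gives at once the density of V and the inner product. *)
Definition dual_sqr f : R := sup (range (fun y => 2 * complex.Re (f y) - q y)).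
Definition dual_norm f : R := Num.sqrt (dual_sqr f).

Let has_sup_dual f : has_sup (range (fun y => 2 * complex.Re (f y) - q y)).
Proof.
split; first by eexists; exists 0.
have /asboolP[_ [M fM]] := valP f; exists (M ^+ 2) => _ [y _ <-].
have := Re_le_rnorm (f y : R[i]); have := fM y; rewrite -sqr_psd_norm.
have := sqr_ge0 (M - psd_norm h y); lra.
Qed.

Lemma dual_sqr_ub f y : 2 * complex.Re (f y) - q y <= dual_sqr f.
Proof. by apply: sup_upper_bound; [exact: has_sup_dual | exists y]. Qed.

Lemma dual_sqr_le f (M : R) :
  (forall y, 2 * complex.Re (f y) - q y <= M) -> dual_sqr f <= M.
Proof.
by move=> fM; apply: ge_sup => [|_ [y _ <-]];
  [have [] := has_sup_dual f | exact: fM].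
Qed.

Lemma dual_sqr_ge0 f : 0 <= dual_sqr f.
Proof.
have := dual_sqr_ub f 0.
by rewrite cfun0 /psd_sqr psd0l /= mulr0 subr0.
Qed.

Lemma sqr_dual_norm f : dual_norm f ^+ 2 = dual_sqr f.
Proof. by rewrite sqr_sqrtr// dual_sqr_ge0. Qed.

Lemma dual_norm_ge0 f : 0 <= dual_norm f. Proof. exact: sqrtr_ge0. Qed.

Lemma le_dual_norm f x : rnorm (f x : R[i]) <= dual_norm f * psd_norm h x.
Proof.
rewrite -(@ler_pXn2r _ 2%N) ?nnegrE ?mulr_ge0 ?rnorm_ge0 ?psd_norm_ge0//;
  last exact: dual_norm_ge0.
rewrite exprMn sqr_dual_norm sqr_psd_norm mulrC.
apply: quadratic_bound => [|a]; first exact: psd_ge0.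
have := dual_sqr_ub f (a^* *: x); rewrite cfun_argZ conjCK.
rewrite /psd_sqr psdZl psdZr mulrA mulc_conj ReZ rnorm_conj; lra.
Qed.

Lemma dual_norm_le f (M : R) : 0 <= M ->
  (forall x, rnorm (f x : R[i]) <= M * psd_norm h x) -> dual_norm f <= M.
Proof.
move=> M0 fM; rewrite -(@ler_pXn2r _ 2%N) ?nnegrE ?dual_norm_ge0//.
rewrite sqr_dual_norm; apply: dual_sqr_le => y.
have := Re_le_rnorm (f y : R[i]); have := fM y; rewrite -sqr_psd_norm.
have := sqr_ge0 (M - psd_norm h y); lra.
Qed.

Let norm f : R[i] := (dual_norm f)%:C%C.

Let normD f g : norm (f + g) <= norm f + norm g.
Proof.
rewrite /norm -rmorphD lecR; apply: dual_norm_le => [|x].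
  by rewrite addr_ge0 ?dual_norm_ge0.
by rewrite (le_trans (ler_rnormD _ _))// mulrDl lerD// le_dual_norm.
Qed.

Let dual_normZ_le a f : dual_norm (a *: f) <= rnorm a * dual_norm f.
Proof.
apply: dual_norm_le => [|x];
  first by rewrite mulr_ge0 ?rnorm_ge0 ?dual_norm_ge0.
by rewrite cfunZ rnormM -mulrA ler_wpM2l ?rnorm_ge0 ?le_dual_norm.
Qed.

Let normZ a f : norm (a *: f) = `|a| * norm f.
Proof.
rewrite /norm rnormE -rmorphM; congr (_%:C)%C; apply/le_anti/andP.
split; first exact: dual_normZ_le.
have [->|a0] := eqVneq a 0; first by rewrite rnorm0 mul0r dual_norm_ge0.
have na : 0 < rnorm a by rewrite rnorm_gt0 a0.
have := dual_normZ_le a^-1 (a *: f); rewrite scalerA mulVf// scale1r.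
have -> : rnorm a^-1 = (rnorm a)^-1.
  by apply: (mulfI (lt0r_neq0 na));
    rewrite -rnormM mulfV// rnorm1 mulfV ?gt_eqF.
by rewrite -ler_pdivrMl ?invr_gt0// invrK.
Qed.

Let norm_eq0 f : norm f = 0 -> f = 0.
Proof.
move=> /(@complexI R) f0; apply: cfun_ext => x; apply: le_rnorm_eq0 => e e0.
by rewrite (le_trans (le_dual_norm f x))// f0 mul0r ltW.
Qed.

HB.instance Definition _ :=
  Lmodule_isNormed.Build R[i] completion normD normZ norm_eq0.

Lemma rnorm_dual f : rnorm f = dual_norm f. Proof. by []. Qed.

End Completion.

Section CompletionInner.
Variables (R : realType) (V : lmodType R[i]) (h : psd_form V).
Implicit Types (f g : completion h) (x y : V).

Local Notation q := (psd_sqr h).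

Fact embed_subproof x : (h x : V -> R[i]^o) \in bounded_conj_linear h.
Proof.
apply/asboolP; split=> [a y z|]; first by rewrite psdDr psdZr.
by exists (psd_norm h x) => y; exact: psd_Cauchy_Schwarz.
Qed.

Definition embed x : completion h := Completion (embed_subproof x).

Fact embed_linear : linear embed.
Proof. by move=> a x y; apply: cfun_ext => z; rewrite /= psdDl psdZl. Qed.

HB.instance Definition _ :=
  GRing.isLinear.Build R[i] V (completion h) *:%R embed embed_linear.

Lemma dual_sqrN f : dual_sqr (- f) = dual_sqr f.
Proof. by rewrite -!sqr_dual_norm -!rnorm_dual rnormN. Qed.

Lemma dual_sqrZ a f : dual_sqr (a *: f) = rnorm a ^+ 2 * dual_sqr f.
Proof. by rewrite -!sqr_dual_norm -!rnorm_dual rnormZ exprMn. Qed.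

(** Completing the square: substitute x + y for y in the supremum. *)
Lemma dual_sqrD_embed f x :
  dual_sqr (f + embed x) = dual_sqr f + 2 * complex.Re (f x) + q x.
Proof.
have shift y : 2 * complex.Re ((f + embed x) (x + y)) - q (x + y) =
    2 * complex.Re (f y) - q y + 2 * complex.Re (f x) + q x.
  have := psd_sqrDZ h x y 1.
  rewrite scale1r mul1r rnorm1 expr1n mul1r => ->.
  rewrite cfunD cfun_argD /= psdDr !ReD (Re_psdC h y) /psd_sqr; ring.
apply/le_anti/andP; split.
  apply: dual_sqr_le => y; have -> : y = x + (y - x) by rewrite addrC subrK.
  by rewrite shift; have := dual_sqr_ub f (y - x); lra.
have : dual_sqr f <= dual_sqr (f + embed x) - 2 * complex.Re (f x) - q x.
  apply: dual_sqr_le => y.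
  by have := dual_sqr_ub (f + embed x) (x + y); rewrite shift; lra.
lra.
Qed.

(** A near-maximiser x of the supremum defining dual_sqr f is close to f, since
    dual_sqr (f - embed x) is exactly the defect of x. *)
Lemma embed_dense f (e : R) : 0 < e -> exists x, rnorm (f - embed x) < e.
Proof.
move=> e0; have e20 : 0 < e ^+ 2 by rewrite exprn_gt0.
have supf : has_sup (range (fun y => 2 * complex.Re (f y) - q y)).
  split; first by eexists; exists 0.
  by exists (dual_sqr f) => _ [y _ <-]; exact: dual_sqr_ub.
have [_ [x _ <-] fx] := sup_adherent e20 supf.
exists x; rewrite -(@ltr_pXn2r _ 2%N) ?nnegrE ?rnorm_ge0 ?(ltW e0)//.
rewrite rnorm_dual sqr_dual_norm -raddfN dual_sqrD_embed.
rewrite cfun_argN psd_sqrN ReN; rewrite -/(dual_sqr f) in fx; lra.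
Qed.

(** The real part of the inner product, by polarisation.  Its bilinearity is
    not computed from the parallelogram law: pairing with an embedded vector
    is evaluation, which is linear, and embedded vectors are dense. *)
Definition polar f g : R := (dual_sqr (f + g) - dual_sqr (f - g)) / 4.

Lemma polar_embedD f g x :
  polar f (g + embed x) = polar f g + complex.Re (f x).
Proof.
rewrite /polar opprD !addrA dual_sqrD_embed -raddfN dual_sqrD_embed.
by rewrite !cfunD cfunN !cfun_argN psd_sqrN !(ReD, ReN); field.
Qed.

Lemma polar_small f g : `|polar f g| <= rnorm g * (rnorm f + rnorm g).
Proof.
have := ler_rnormD (f - g) (g + g); rewrite addrA subrK => le1.
have := ler_rnormD (f + g) (- g - g); rewrite addrA addrK => le2.
have := ler_rnormD f g; have := ler_rnormD f (- g).
have := ler_rnormD (- g) (- g); have := ler_rnormD g g; rewrite !rnormN.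
have := rnorm_ge0 (f + g); have := rnorm_ge0 (f - g).
rewrite ler_norml /polar -!sqr_dual_norm -!rnorm_dual.
have := rnorm_ge0 f; have := rnorm_ge0 g; move: le1 le2.
move: (rnorm (f + g)) (rnorm (f - g)) (rnorm f) (rnorm g) (rnorm (- g - g))
  (rnorm (g + g)).
move=> a b c d k l *; apply/andP; split; nra.
Qed.

Lemma polarC f g : polar g f = polar f g.
Proof. by rewrite /polar (addrC g) -(dual_sqrN (g - f)) opprB. Qed.

Lemma polarNl f g : polar (- f) g = - polar f g.
Proof.
rewrite /polar -(dual_sqrN (- f + g)) -(dual_sqrN (- f - g)) !opprD !opprK.
ring.
Qed.

Lemma polarii f g : polar ('i%C *: f) ('i%C *: g) = polar f g.
Proof.
by rewrite /polar -scalerDr -scalerBr !dual_sqrZ rnorm_i expr1n !mul1r.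
Qed.

Definition completion_inner f g : R[i] :=
  (polar f g +i* polar f ('i *: g))%C.

Local Notation "''[' f , g ]" := (completion_inner f g).

Lemma completion_inner_embedD f g x : '[f, g + embed x] = '[f, g] + f x.
Proof.
rewrite /completion_inner scalerDr -[_ *: embed x]linearZ /= !polar_embedD.
rewrite cfun_argZ; apply: eqC_ReIm => /=; case: (f x) => a b //=; congr (_ + _).
ring.
Qed.

Lemma completion_inner_small f g :
  rnorm ('[f, g]) <= 2 * (rnorm g * (rnorm f + rnorm g)).
Proof.
have := polar_small f ('i%C *: g); rewrite rnormZ rnorm_i mul1r => B2.
have -> : '[f, g] = (polar f g)%:C%C + 'i%C * (polar f ('i *: g))%:C%C.
  exact: complexE.
rewrite (le_trans (ler_rnormD _ _))// rnormM rnorm_i mul1r !rnorm_realC.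
have := polar_small f g; lra.
Qed.

Let inner_linearl a f f' g : '[a *: f + f', g] = a * '[f, g] + '[f', g].
Proof.
apply/eqP; rewrite -subr_eq0; apply/eqP/le_rnorm_eq0 => d d0.
pose C := rnorm (a *: f + f') + 1 + rnorm a * (rnorm f + 1) + (rnorm f' + 1).
apply: (@le_small _ _ _ (2 * C)).
  by rewrite mulr_ge0 ?addr_ge0 ?mulr_ge0 ?addr_ge0 ?rnorm_ge0.
move=> e /andP[e0 e1]; have [x] := embed_dense g e0.
move: (g - embed x) (subrK (embed x) g) => r <- re.
rewrite !completion_inner_embedD cfunD cfunZ.
have bound k : rnorm ('[k, r]) <= 2 * (e * (rnorm k + 1)).
  rewrite (le_trans (completion_inner_small _ _))// ler_wpM2l//.
  by rewrite ler_pM ?addr_ge0 ?rnorm_ge0 ?(ltW re)// lerD2l (le_trans (ltW re)).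
move: (bound (a *: f + f')) (bound f) (bound f').
rewrite /C; move: (rnorm (a *: f + f')) (rnorm f) (rnorm f') => n1 n2 n3.
move: ('[a *: f + f', r]) ('[f, r]) ('[f', r]) (f x : R[i]) (f' x : R[i]).
move=> z1 z2 z3 w w' b1 /(ler_wpM2l (rnorm_ge0 a)) b2 b3.
have -> : z1 + (a * w + w') - (a * (z2 + w) + (z3 + w')) = z1 - a * z2 - z3.
  by ring.
rewrite (le_trans (ler_rnormD _ _))// rnormN.
have := ler_rnormD z1 (- (a * z2)); rewrite rnormN rnormM; lra.
Qed.

Let inner_hermitian f g : '[f, g] = (-1) ^+ false * ('[g, f])^*.
Proof.
rewrite expr0 mul1r /completion_inner; apply: eqC_ReIm => /=.
  by rewrite polarC.
have -> : polar g ('i%C *: f) = - polar f ('i%C *: g).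
  by rewrite -polarii scalerA -expr2 sqr_i scaleN1r polarC polarNl.
by rewrite opprK.
Qed.

Fact completion_inner_bilinear :
  bilinear_for *%R ((@Num.conj R[i]) \; *%R) completion_inner.
Proof.
split=> [g a f f'|f a g g'] /=; first exact: inner_linearl.
have C u v : '[u, v] = ('[v, u])^*.
  by have := inner_hermitian u v; rewrite expr0 mul1r.
by rewrite (C f (a *: g + g')) inner_linearl (C f g) (C f g') rmorphD rmorphM.
Qed.

HB.instance Definition _ :=
  bilinear_isBilinear.Build R[i] (completion h) (completion h) R[i]
    *%R ((@Num.conj R[i]) \; *%R) completion_inner completion_inner_bilinear.

HB.instance Definition _ :=
  isHermitianSesquilinear.Build R[i] (completion h) false (@Num.conj R[i])
    completion_inner inner_hermitian.

Fact completion_inner_norm f : completion_inner f f = `|f| ^+ 2.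
Proof.
rewrite rnormE -rmorphXn rnorm_dual sqr_dual_norm /completion_inner /polar.
have -> : f + f = (2%:C)%C *: f.
  by rewrite (_ : 2%:C%C = 1 + 1) ?scalerDl ?scale1r // -rmorphD.
rewrite subrr -[X in _ - dual_sqr X](scale0r f) !dual_sqrZ rnorm_realC rnorm0.
rewrite ger0_norm// expr0n mul0r subr0.
have ii : dual_sqr (f + 'i%C *: f) = dual_sqr (f - 'i%C *: f).
  have -> : f + 'i%C *: f = 'i%C *: (f - 'i%C *: f).
    by rewrite scalerBr scalerA -expr2 sqr_i scaleN1r opprK addrC.
  by rewrite dual_sqrZ rnorm_i expr1n mul1r.
by rewrite ii subrr mul0r; congr (_ +i* _)%C; field.
Qed.

Fact completion_inner_gt0 f : f != 0 -> 0 < completion_inner f f.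
Proof. by move=> f0; rewrite completion_inner_norm exprn_gt0 ?normr_gt0. Qed.

HB.instance Definition _ :=
  isDotProduct.Build R[i] (completion h) completion_inner completion_inner_gt0.

(** The balls belonging to a Cauchy filter, with their radii as errors, form a
    family whose values at each vector of V have a limit; the errors are
    proportional to the seminorm, so the limit functional is bounded. *)
Fact completion_complete (F : set_system (completion h)) :
  ProperFilter F -> cauchy F -> cvg F.
Proof.
move=> FF /cauchyP Fc.
pose I := {p : completion h * R | F (ball p.1 p.2%:C%C)}.
pose u (i : I) := (sval i).1; pose e (i : I) := (sval i).2.
have e_small (r : R) : 0 < r -> exists i, e i <= r.
  move=> r0; have [f Ff] := Fc r%:C%C ltac:(by rewrite ltcR).
  by exists (exist _ (f, r) Ff).
have ue i j : rnorm (u i - u j) <= e i + e j.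
  have [g [/ball_rnormP ig /ball_rnormP jg]] :=
    filter_ex (filterI (svalP i) (svalP j)).
  rewrite (le_trans (ler_rdistD g _ _))// lerD ?(ltW ig)// rnormB.
  exact: ltW.
have [i0 _] := e_small 1 ltr01.
have lim y : exists z : R[i], forall i, rnorm (u i y - z) <=
  2 * (e i * psd_norm h y).
  apply: complex_family_limit i0 _ _ _ => i j.
  rewrite -mulrDl.
  rewrite (le_trans (le_dual_norm (u i - u j) y))// ler_wpM2r ?psd_norm_ge0//.
  exact: ue.
have [f uf] := choice lim.
have lf : conj_linear f.
  move=> a x y; apply/eqP; rewrite -subr_eq0; apply/eqP.
  apply: le_rnorm_eq0 => r r0.
  pose C := psd_norm h (a *: x + y) + rnorm a * psd_norm h x + psd_norm h y.
  apply: (@le_small _ _ _ (2 * C)).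
    by rewrite mulr_ge0 ?addr_ge0 ?mulr_ge0 ?psd_norm_ge0 ?rnorm_ge0.
  move=> s /andP[s0 _]; have [i ei] := e_small s s0.
  have b z : rnorm (u i z - f z) <= 2 * (s * psd_norm h z).
    by rewrite (le_trans (uf z i))// ler_wpM2l// ler_wpM2r ?psd_norm_ge0.
  have -> : f (a *: x + y) - (a^* * f x + f y) =
    - (u i (a *: x + y) - f (a *: x + y)) + (a^* * (u i x - f x) + (u i y - f
        y)).
    by rewrite cfunP; ring.
  rewrite (le_trans (ler_rnormD _ _))// rnormN.
  have := ler_rnormD (a^* * (u i x - f x)) (u i y - f y).
  rewrite rnormM rnorm_conj.
  have := b (a *: x + y); have := b y; have := ler_wpM2l (rnorm_ge0 a) (b x).
  rewrite /C; lra.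
have f_bd : (f : V -> R[i]^o) \in bounded_conj_linear h.
  apply/asboolP; split=> //; have [i ei] := e_small 1 ltr01.
  exists (dual_norm (u i) + 2 * e i) => y.
  have := ler_rdistD (u i y : R[i]) (f y) 0; rewrite !subr0 rnormB.
  by have := uf y i; have := le_dual_norm (u i) y; lra.
pose l := Completion f_bd.
have ul i : rnorm (u i - l) <= 2 * e i.
  have ei0 : 0 <= e i by have := ue i i; rewrite subrr rnorm0; lra.
  rewrite rnorm_dual; apply: dual_norm_le => [|y]; first by rewrite mulr_ge0.
  by rewrite -mulrA; exact: uf.
apply/cvg_ex; exists l => A /nbhs_ballP[d d0 dA].
have dR : d = (complex.Re d)%:C%C by rewrite -ge0_complexE// ltW.
have d40 : 0 < complex.Re d / 4 by rewrite divr_gt0// -ltcR -dR.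
have [i ei] := e_small _ d40.
apply: filterS (svalP i) => g /ball_rnormP ig.
apply: dA; rewrite dR; apply/ball_rnormP; rewrite rnormB.
apply: (le_lt_trans (ler_rdistD (u i) g l)); rewrite (rnormB g).
by apply: (lt_le_trans (ltr_leD ig (ul i))); move: ei; rewrite /e; lra.
Qed.

HB.instance Definition _ :=
  Uniform_isComplete.Build (completion h) completion_complete.

HB.instance Definition _ :=
  isHilbert.Build R (completion h) completion_inner_norm.

Lemma inner_embedr f x : inner f (embed x) = f x.
Proof.
have -> : inner f (embed x) = completion_inner f (embed x) by [].
have i0 : completion_inner f 0 = 0.
  rewrite /completion_inner /polar scaler0 !addr0 !subr0 subrr mul0r.
  by apply: eqC_ReIm.
by have := completion_inner_embedD f 0 x; rewrite add0r i0 add0r.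
Qed.

Lemma inner_embed x y : inner (embed x) (embed y) = h x y.
Proof. by rewrite inner_embedr. Qed.

Lemma embed_total f : (forall x, inner (embed x) f = 0) -> f = 0.
Proof.
move=> ef; apply: cfun_ext => x.
by rewrite -inner_embedr innerC ef rmorph0.
Qed.

End CompletionInner.

(** The interface of the construction: j is isometric for h and has dense
    range, density being expressed by the absence of orthogonal vectors. *)
Theorem psd_completion (R : realType) (V : lmodType R[i]) (h : psd_form V) :
  exists (K : hilbertType R) (j : {linear V -> K}),
    (forall x y, inner (j x) (j y) = h x y) /\
    (forall k, (forall x, inner (j x) k = 0) -> k = 0).
Proof.
by exists (completion h), (embed h); split;
  [exact: inner_embed | exact: embed_total].
Qed.

(** * The Gelfand-Naimark-Segal representation *)

Section GNS.
Variables (R : realType) (H : hilbertType R).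
Implicit Types c x y z : 'B(H).

(** The states of B(H), characterised through numerical ranges: positivity,
    hermitian symmetry, the value 1 at the identity and contractivity all
    follow by testing suitable operators, without square roots of positive
    operators, and the condition is a bound by a sublinear functional, which
    is what the Hahn-Banach theorem provides. *)
Definition numerically_dominated (p : 'B(H) -> R[i]) :=
  forall c (M : R),
    (forall v, rnorm v = 1 -> complex.Re (inner (c v) v) <= M) ->
    complex.Re (p c) <= M.

Variable p : {scalar 'B(H)}.
Hypothesis pN : numerically_dominated p.

Lemma dominated_ge0 c : (forall v, 0 <= complex.Re (inner (c v) v)) ->
  0 <= complex.Re (p c).
Proof.
move=> c0; rewrite -oppr_le0 -ReN -raddfN; apply: pN => v _.
by rewrite bopN innerNl ReN oppr_le0.
Qed.

Lemma dominated_eq c c' :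
  (forall v, complex.Re (inner (c v) v) = complex.Re (inner (c' v) v)) ->
  complex.Re (p c) = complex.Re (p c').
Proof.
move=> cc'; apply/eqP; rewrite eq_le -subr_ge0 -[X in _ && X]subr_ge0 -!ReB
  -!raddfB.
by apply/andP; split; apply: dominated_ge0 => v;
  rewrite bopB innerBl ReB cc' subrr.
Qed.

Lemma dominated_adj c : p (opadj c) = (p c)^*.
Proof.
have Re_adj d : complex.Re (p (opadj d)) = complex.Re (p d).
  by apply: dominated_eq => v; rewrite -opadjPr Re_innerC.
apply: eqC_ReIm; first by rewrite Re_conj Re_adj.
have := Re_adj ('i%C *: c).
have -> : opadj ('i%C *: c) = - ('i%C *: opadj c).
  have := opadj_lin 'i%C c 0.
  have -> : opadj (0 : 'B(H)) = 0.
    by apply: opadj_uniq => u v; rewrite inner0l inner0r.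
  rewrite !addr0 => ->; rewrite -scaleNr; congr (_ *: _).
  by apply: eqC_ReIm; rewrite /= ?oppr0.
have pZ a d : p (a *: d) = a * p d by exact: linearZ_LR.
rewrite raddfN /= ReN !pZ !Re_mulI opprK => ->.
by case: (p c).
Qed.

Lemma dominated_id : complex.Re (p (opid H)) = 1.
Proof.
have v1 (v : H) : rnorm v = 1 -> complex.Re (inner v v) = 1.
  by move=> v1; rewrite inner_self v1 expr1n.
apply/le_anti/andP; split; first by apply: pN => v /v1 /= ->.
rewrite -lerN2 -ReN -raddfN; apply: pN => v /v1 vv.
by rewrite bopN innerNl ReN /= vv.
Qed.

Definition gns_fun x y : R[i] := p (opmul (opadj y) x).

Fact gns_linearl y : scalar (gns_fun^~ y).
Proof. by move=> a x z; rewrite /gns_fun opmul_linr linearP. Qed.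

Fact gns_herm x y : gns_fun x y = (gns_fun y x)^*.
Proof. by rewrite /gns_fun -dominated_adj opadjM opadjK. Qed.

Fact gns_ge0 x : 0 <= complex.Re (gns_fun x x).
Proof.
by apply: dominated_ge0 => v; rewrite inner_adjmul /= sqr_ge0.
Qed.

Definition gns_form := PsdForm gns_linearl gns_herm gns_ge0.

Section GNSOperators.
Variables (K : hilbertType R) (j : {linear 'B(H) -> K}).
Hypothesis inner_j : forall x y, inner (j x) (j y) = gns_form x y.
Hypothesis total_j : forall k, (forall x, inner (j x) k = 0) -> k = 0.

Lemma sqr_rnorm_embed x : rnorm (j x) ^+ 2 = complex.Re (p (opmul (opadj x) x)).
Proof.
have -> : rnorm (j x) ^+ 2 = complex.Re (inner (j x) (j x))
  by rewrite inner_self.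
by rewrite inner_j.
Qed.

(** The operator |c|^2 x^* x - x^* c^* c x has a positive numerical range. *)
Lemma rnorm_embed_mul c x : rnorm (j (opmul c x)) <= opnorm c * rnorm (j x).
Proof.
rewrite -(@ler_pXn2r _ 2%N) ?nnegrE ?mulr_ge0 ?rnorm_ge0 ?opnorm_ge0//.
rewrite exprMn !sqr_rnorm_embed -ReZ -subr_ge0 -ReB -linearZ -raddfB.
apply: dominated_ge0 => v.
rewrite bopB innerBl bopZ innerZl ReB ReZ !inner_adjmul /= subr_ge0.
by rewrite -exprMn ler_pXn2r ?nnegrE ?mulr_ge0 ?rnorm_ge0 ?opnorm_ge0
  ?le_opnorm.
Qed.

Lemma embed_ext (k k' : K) :
  (forall x, inner (j x) k = inner (j x) k') -> k = k'.
Proof.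
move=> kk'; apply/eqP; rewrite -subr_eq0; apply/eqP/total_j => x.
by rewrite innerBr kk' subrr.
Qed.

(** Left multiplication by c is extended to the completion through its
    adjoint, the transpose of left multiplication by the adjoint of c. *)
Definition gns_op c (k : K) : K :=
  riesz j (fun x => inner (j (opmul (opadj c) x)) k).

Let gns_op_scalar c (k : K) : scalar (fun x => inner (j (opmul (opadj c) x)) k).
Proof. by move=> a x y; rewrite opmul_linr linearP innerDl innerZl. Qed.

Let gns_op_bound c (k : K) x : rnorm (inner (j (opmul (opadj c) x)) k) <=
  opnorm (opadj c) * rnorm k * rnorm (j x).
Proof.
rewrite (le_trans (Cauchy_Schwarz _ _))// mulrAC.
by rewrite ler_wpM2r ?rnorm_ge0 ?rnorm_embed_mul.
Qed.

Let gns_op_M c (k : K) : 0 <= opnorm (opadj c) * rnorm k.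
Proof. by rewrite mulr_ge0 ?opnorm_ge0 ?rnorm_ge0. Qed.

Lemma gns_opE c k x : inner (j x) (gns_op c k) =
  inner (j (opmul (opadj c) x)) k.
Proof. by have [->] := rieszP (gns_op_M c k) (gns_op_scalar c k) (gns_op_bound
  c k). Qed.

Fact gns_op_bounded c : gns_op c \in @bounded_linear R K K.
Proof.
apply: (@bounded_linearP _ _ _ _ (opnorm (opadj c))) => [a k l|k].
  by apply: embed_ext => x; rewrite innerDr innerZr !gns_opE innerDr innerZr.
exact: rnorm_riesz (gns_op_M c k) (gns_op_scalar c k) (gns_op_bound c k).
Qed.

Definition gns_rep c : 'B(K) := Bop (gns_op_bounded c).

Lemma gns_rep_embed c x : gns_rep c (j x) = j (opmul c x).
Proof.
apply: embed_ext => y; rewrite gns_opE !inner_j /= /gns_fun.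
by rewrite opmulA opadjM.
Qed.

Fact gns_rep_linear : linear gns_rep.
Proof.
move=> a c d; apply: bop_ext => k; apply: embed_ext => x.
rewrite bopD bopZ innerDr innerZr !gns_opE opadj_lin opmul_linl.
by rewrite linearP innerDl innerZl.
Qed.

Lemma gns_repM c d : gns_rep (opmul c d) = opmul (gns_rep c) (gns_rep d).
Proof.
apply: bop_ext => k; apply: embed_ext => z /=.
by rewrite !gns_opE opadjM opmulA.
Qed.

Lemma gns_rep_adj c : gns_rep (opadj c) = opadj (gns_rep c).
Proof.
apply: bop_ext => k; apply: embed_ext => z.
by rewrite -opadjP gns_rep_embed gns_opE opadjK.
Qed.

Lemma gns_rep_vector c : inner (gns_rep c (j (opid H))) (j (opid H)) = p c.
Proof.
rewrite gns_rep_embed inner_j /= /gns_fun; congr (p _).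
rewrite opadj_id; exact: bop_ext.
Qed.

End GNSOperators.

(** B(H) acts by left multiplication on the completion of B(H) for the form
    p (y^* x), and the vector state is that of the class of the identity. *)
Theorem gns_representation : exists (L : hilbertType R)
    (pi : {linear 'B(H) -> 'B(L)}) (xi : L),
  [/\ forall x y, pi (opmul x y) = opmul (pi x) (pi y),
      forall x, pi (opadj x) = opadj (pi x),
      forall x, inner (pi x xi) xi = p x &
      rnorm xi = 1].
Proof.
have [K [j [inner_j total_j]]] := psd_completion gns_form.
have [pi piE] := ex_linear (gns_rep_linear inner_j total_j).
exists K, pi, (j (opid H)); split=> [x y|x|x|]; rewrite ?piE.
- exact: gns_repM.
- exact: gns_rep_adj.
- exact: gns_rep_vector.
apply: (pexpIrn (n := 2)); rewrite ?nnegrE ?rnorm_ge0// expr1n.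
rewrite -dominated_id sqr_rnorm_embed//; congr (complex.Re (p _)).
rewrite opadj_id; exact: bop_ext.
Qed.

End GNS.

(** * The Hahn-Banach theorem *)

Section InfimumOfFamily.
Variables (R : realType) (I : Type) (i0 : I) (F : I -> R).
Hypothesis F_lb : exists b, forall i, b <= F i.

Lemma has_inf_family : has_inf (range F).
Proof.
split; first by exists (F i0), i0.
by have [b bF] := F_lb; exists b => _ [i _ <-].
Qed.

Lemma inf_family_le i : inf (range F) <= F i.
Proof. by apply: inf_lbound; [have [] := has_inf_family | exists i]. Qed.

Lemma inf_family_adherent e : 0 < e -> exists i, F i < inf (range F) + e.
Proof.
by move=> e0; have [_ [i _ <-] ?] := inf_adherent e0 has_inf_family; exists i.
Qed.

End InfimumOfFamily.

Section HahnBanach.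
Variables (R : realType) (V : lmodType R[i]).
Implicit Types (q : V -> R) (x y : V).

Definition sublinear q :=
  (forall x y, q (x + y) <= q x + q y) /\
  (forall (t : R) x, 0 < t -> q (t%:C%C *: x) <= t * q x).

Lemma sublinear0 q : sublinear q -> q 0 = 0.
Proof.
move=> [_ qZ]; apply/le_anti/andP; split.
  have := qZ 2^-1 0 ltac:(by rewrite invr_gt0); rewrite scaler0; lra.
by have := qZ 2 0 ltac:(by []); rewrite scaler0; lra.
Qed.

Lemma sublinearZ q (t : R) x : sublinear q -> 0 <= t ->
  q (t%:C%C *: x) = t * q x.
Proof.
move=> sq; rewrite le_eqVlt => /orP[/eqP<-|t0].
  by rewrite scale0r mul0r sublinear0.
have [_ qZ] := sq; apply/le_anti/andP; split; first exact: qZ.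
have ti : 0 < t^-1 by rewrite invr_gt0.
have := qZ t^-1 (t%:C%C *: x) ti.
rewrite scalerA -rmorphM mulVf ?gt_eqF// rmorph1 scale1r.
by rewrite -(ler_pM2l t0) mulrA mulfV ?gt_eqF// mul1r.
Qed.

Lemma sublinear_geN q x : sublinear q -> - q (- x) <= q x.
Proof.
move=> sq; have [qD _] := sq; have := qD x (- x).
by rewrite subrr sublinear0//; lra.
Qed.

(** The common pattern of the three infima taken below: over a chain, along a
    half-line, and over the constraints of a cone. *)
Lemma sublinear_inf I (i0 : I) (F : I -> V -> R) :
  (forall x, exists b, forall i, b <= F i x) ->
  (forall i j x y, exists k, F k (x + y) <= F i x + F j y) ->
  (forall (t : R) i x, 0 < t -> exists k, F k (t%:C%C *: x) <= t * F i x) ->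
  sublinear (fun x => inf (range (F^~ x))).
Proof.
move=> Fb FD FZ; split=> [x y|t x t0]; apply/ler_addgt0Pr => e e0.
  have e20 : 0 < e / 2 by rewrite divr_gt0.
  have [i Fi] := inf_family_adherent i0 (Fb x) e20.
  have [j Fj] := inf_family_adherent i0 (Fb y) e20.
  have [k Fk] := FD i j x y.
  by have := inf_family_le i0 (Fb (x + y)) k; lra.
have et0 : 0 < e / t by rewrite divr_gt0.
have [i Fi] := inf_family_adherent i0 (Fb x) et0.
have [k Fk] := FZ t i x t0.
have := inf_family_le i0 (Fb (t%:C%C *: x)) k.
have : t * F i x <= t * inf (range (F^~ x)) + e.
  by rewrite (le_trans (ler_wpM2l (ltW t0) (ltW Fi)))//
    mulrDr mulrCA divff ?gt_eqF// mulr1.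
lra.
Qed.

(** Below a sublinear functional there is a minimal one: this is Zorn's lemma,
    the infimum of a chain being sublinear because any two members of the
    chain are comparable. *)
Lemma minimal_sublinear q : sublinear q ->
  exists m, [/\ sublinear m, forall x, m x <= q x &
    forall m', sublinear m' -> (forall x, m' x <= m x) ->
      forall x, m x <= m' x].
Proof.
move=> sq; pose T := {m : V -> R | sublinear m /\ forall x, m x <= q x}.
pose le (s t : T) := `[< forall x, sval t x <= sval s x >].
pose t0 : T := exist _ q (conj sq (fun x => lexx _)).
have [||A totA|[m [sm mq]] mmin] := @ZL_preorder T t0 le.
- by move=> t; apply/asboolP.
- move=> r s t /asboolP rs /asboolP st; apply/asboolP => x.
  exact: le_trans (st x) (rs x).
- have [[a Aa]|A0] := pselect (exists a, A a); last first.
    by exists t0 => s As; case: A0; exists s.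
  pose I := {s : T | A s}; pose F (i : I) := sval (sval i).
  pose i0 : I := exist _ a Aa.
  have Fs i : sublinear (F i) by have [] := svalP (sval i).
  have Fq i x : F i x <= q x by have [_ iq] := svalP (sval i); exact: iq.
  have Fb x : exists b, forall i, b <= F i x.
    exists (- q (- x)) => i; apply: (le_trans _ (sublinear_geN x (Fs i))).
    by rewrite lerN2 Fq.
  have sg : sublinear (fun x => inf (range (F^~ x))).
    apply: (sublinear_inf i0) => // [i j x y|t i x t1]; last first.
      by exists i; have [_ FZ] := Fs i; exact: FZ.
    have [Di _] := Fs i; have [Dj _] := Fs j.
    have [/asboolP ij|/asboolP ji] := totA _ _ (svalP i) (svalP j).
      by exists j; rewrite (le_trans (Dj x y))// lerD2r; exact: ij.
    by exists i; rewrite (le_trans (Di x y))// lerD2l; exact: ji.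
  have gq x : inf (range (F^~ x)) <= q x.
    by apply: (le_trans (inf_family_le i0 (Fb x) i0)); exact: Fq.
  exists (exist _ (fun x => inf (range (F^~ x))) (conj sg gq)) => s As.
  by apply/asboolP => x; exact: (inf_family_le i0 (Fb x) (exist _ s As)).
- exists m; split=> // m' sm' m'm.
  have m'q x : m' x <= q x by rewrite (le_trans (m'm x)).
  pose t' : T := exist _ m' (conj sm' m'q).
  by have /asboolP := mmin t' (asboolT m'm).
Qed.

(** A minimal sublinear functional m is odd: for each y the functional
    x |-> inf_t (m (x + t y) - t m y) is sublinear and below m, hence equal to
    m, and its value at - y is at most - m y. *)
Lemma minimal_sublinear_odd m : sublinear m ->
  (forall m', sublinear m' -> (forall x, m' x <= m x) ->
     forall x, m x <= m' x) ->
  forall y, m (- y) = - m y.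
Proof.
move=> sm mmin y; have [mD mZ] := sm.
pose I := {t : R | 0 <= t}; pose i0 : I := exist _ 0 (lexx 0).
pose F (i : I) x := m (x + (sval i)%:C%C *: y) - sval i * m y.
have Fb x : exists b, forall i, b <= F i x.
  exists (- m (- x)) => -[t t0]; rewrite /F /=.
  have := mD (- x) (x + t%:C%C *: y).
  by rewrite addrA addNr add0r sublinearZ//; lra.
have sF : sublinear (fun x => inf (range (F^~ x))).
  apply: (sublinear_inf i0) => // [[t t0] [t' t'0] x x'|s [t t0] x s0].
    exists (exist _ (t + t') (addr_ge0 t0 t'0)); rewrite /F /=.
    have := mD (x + t%:C%C *: y) (x' + t'%:C%C *: y).
    by rewrite addrACA -scalerDl -rmorphD; lra.
  exists (exist _ (s * t) (mulr_ge0 (ltW s0) t0)); rewrite /F /=.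
  have := mZ s (x + t%:C%C *: y) s0.
  by rewrite scalerDr scalerA -rmorphM; lra.
have Fm x : inf (range (F^~ x)) <= m x.
  have := inf_family_le i0 (Fb x) i0.
  by rewrite {2}/F /= scale0r addr0 mul0r subr0.
have i1 : 0 <= 1 :> R by [].
have := inf_family_le i0 (Fb (- y)) (exist _ 1 i1).
rewrite {2}/F /= scale1r addNr sublinear0// mul1r sub0r => le1.
have := mmin _ sF Fm (- y); have := mD y (- y).
by rewrite subrr sublinear0// => ? ?; apply/le_anti/andP; split; lra.
Qed.

(** A minimal sublinear functional m below q is real-linear by the previous
    lemma, and m is the real part of the complex functional
    m x - i m (i x). *)
Theorem hahn_banach q : sublinear q ->
  exists f : {scalar V}, forall x, complex.Re (f x) <= q x.
Proof.
move=> /minimal_sublinear[m [sm mq /(minimal_sublinear_odd sm) mN]].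
have [mD _] := sm.
have {}mD x y : m (x + y) = m x + m y.
  apply/le_anti/andP; split; first exact: mD.
  by have := mD (x + y) (- y); rewrite addrK mN; lra.
have mZ (t : R) x : m (t%:C%C *: x) = t * m x.
  have [t0|t0] := leP 0 t; first exact: sublinearZ.
  rewrite -[t]opprK rmorphN scaleNr mN sublinearZ ?mulNr// oppr_ge0 ltW//.
have mC a x : m (a *: x) = complex.Re a * m x + complex.Im a * m ('i%C *: x).
  rewrite -!mZ -mD scalerA -scalerDl; congr (m (_ *: _)).
  by rewrite [LHS]complexE mulrC.
pose f x := (m x -i* m ('i *: x))%C.
have [g gf] : exists g : {scalar V}, forall x, g x = f x.
  apply: ex_scalar => a x y; rewrite /f scalerDr.
  have -> : 'i%C *: (a *: x) = a *: ('i%C *: x) by rewrite !scalerA mulrC.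
  have mii : m ('i%C *: ('i%C *: x)) = - m x.
    by rewrite scalerA -expr2 sqr_i scaleN1r mN.
  rewrite !mD (mC a x) (mC a ('i%C *: x)) mii;
    move: (m x) (m y) (m ('i%C *: x)) (m ('i%C *: y)).
  by case: a => s t k l k' l' /=; apply: eqC_ReIm => /=; ring.
by exists g => x; rewrite gf /= mq.
Qed.

End HahnBanach.

(** * Matrix norms and the dual of the wh'-norm *)

Section SubspaceVal.
Variables (F : pzRingType) (V : lmodType F) (A : submodClosed V).
Implicit Types x y : A.

Lemma sub_valD x y : val (x + y) = val x + val y.
Proof. exact: raddfD. Qed.

Lemma sub_valZ a x : val (a *: x) = a *: val x.
Proof. exact: linearZ. Qed.

Lemma sub_val_sum I (s : seq I) (G : I -> A) :
  val (\sum_(i <- s) G i) = \sum_(i <- s) val (G i).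
Proof. exact: raddf_sum. Qed.

End SubspaceVal.

Section L2Norm.
Variables (R : realType) (V : normedZmodType R[i]) (n : nat).
Implicit Types v : 'cV[V]_n.

Lemma l2norm_ge0 v : 0 <= l2norm v. Proof. exact: sqrtr_ge0. Qed.

Lemma sqr_l2norm v : l2norm v ^+ 2 = \sum_i rnorm (v i 0) ^+ 2.
Proof. by rewrite sqr_sqrtr// sumr_ge0// => i _; rewrite sqr_ge0. Qed.

Lemma l2norm_le v (M : R) : 0 <= M ->
  (l2norm v <= M) = (\sum_i rnorm (v i 0) ^+ 2 <= M ^+ 2).
Proof. by move=> M0; rewrite -sqr_l2norm ler_pXn2r ?nnegrE ?l2norm_ge0. Qed.

Lemma le_l2norm v i : rnorm (v i 0) <= l2norm v.
Proof.
rewrite -(@ler_pXn2r _ 2%N) ?nnegrE ?l2norm_ge0 ?rnorm_ge0// sqr_l2norm.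
by rewrite (bigD1 i)//= lerDl sumr_ge0// => k _; rewrite sqr_ge0.
Qed.

End L2Norm.

Lemma l2norm0 (R : realType) (V : normedZmodType R[i]) n :
  l2norm (\col_(i < n) (0 : V)) = 0.
Proof.
apply/eqP; rewrite eq_le l2norm_ge0 andbT l2norm_le// big1// => i _.
by rewrite mxE rnorm0 expr0n.
Qed.

Lemma l2norm1 (R : realType) (V : normedZmodType R[i]) (x : V) :
  l2norm (\col_(i < 1) x) = rnorm x.
Proof. by rewrite /l2norm big_ord1 mxE sqrtr_sqr ger0_norm ?rnorm_ge0. Qed.

Lemma l2normZ (R : realType) (V : normedModType R[i]) n (a : R[i])
    (v : 'I_n -> V) :
  l2norm (\col_i (a *: v i)) = rnorm a * l2norm (\col_i v i).
Proof.
rewrite /l2norm -[rnorm a]ger0_norm ?rnorm_ge0// -sqrtr_sqr -sqrtrM ?sqr_ge0//.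
rewrite mulr_sumr; congr Num.sqrt; apply: eq_bigr => i _.
by rewrite !mxE rnormZ exprMn.
Qed.

Section OperatorMatrices.
Variables (R : realType) (H : hilbertType R).

Definition opmx_apply m n (X : 'M['B(H)]_(m, n)) (v : 'cV[H]_n) : 'cV[H]_m :=
  \col_i \sum_j X i j (v j 0).

(** A crude bound, only there to know that the supremum defining opmxnorm is
    that of a bounded set. *)
Lemma opmx_bounded m n (X : 'M['B(H)]_(m, n)) :
  exists2 C : R, 0 <= C & forall v, l2norm (opmx_apply X v) <= C * l2norm v.
Proof.
pose c i := \sum_j opnorm (X i j).
have c0 i : 0 <= c i by apply: sumr_ge0 => j _; exact: opnorm_ge0.
exists (\sum_i c i) => [|v]; first exact: sumr_ge0.
have S0 : 0 <= \sum_i c i by exact: sumr_ge0.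
rewrite l2norm_le ?mulr_ge0 ?l2norm_ge0//.
have entry i : rnorm (opmx_apply X v i 0) <= c i * l2norm v.
  rewrite mxE mulr_suml (le_trans (ler_rnorm_sum _ _))//.
  apply: ler_sum => j _; rewrite (le_trans (le_opnorm _ _))//.
  by rewrite ler_wpM2l ?opnorm_ge0 ?le_l2norm.
apply: le_trans (_ : \sum_i c i * (\sum_i c i) * l2norm v ^+ 2 <= _).
  apply: ler_sum => i _; apply: le_trans (_ : (c i * l2norm v) ^+ 2 <= _).
    by rewrite ler_pXn2r ?nnegrE ?mulr_ge0 ?rnorm_ge0 ?l2norm_ge0.
  rewrite exprMn ler_wpM2r ?sqr_ge0// expr2 ler_wpM2l//.
  by rewrite (bigD1 i)//= lerDl sumr_ge0.
by rewrite -!mulr_suml exprMn expr2.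
Qed.

Lemma le_opmxnorm m n (X : 'M['B(H)]_(m, n)) v :
  l2norm (opmx_apply X v) <= opmxnorm X * l2norm v.
Proof.
have [C C0 XC] := opmx_bounded X.
have [v0|v0] := eqVneq (l2norm v) 0.
  by rewrite v0 mulr0 (le_trans (XC v))// v0 mulr0.
have vgt : 0 < l2norm v by rewrite lt_def v0 l2norm_ge0.
pose c : R[i] := (l2norm v)^-1%:C%C.
have nc : rnorm c = (l2norm v)^-1
  by rewrite rnorm_realC ger0_norm ?invr_ge0 ?l2norm_ge0.
have vE w : l2norm (\col_i (w : 'cV[H]__) i 0) = l2norm w by congr l2norm;
  apply/matrixP => i k; rewrite mxE ord1.
have : l2norm (opmx_apply X (\col_i (c *: v i 0))) <= opmxnorm X.
  apply: sup_upper_bound.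
    split.
      exists (l2norm (opmx_apply X (\col_i 0))), (\col_i 0) => //=.
      by rewrite l2norm0.
    exists C => _ [w /= w1 <-]; apply: le_trans (XC w) _.
    by rewrite ler_piMr.
  exists (\col_i (c *: v i 0)) => //=.
  by rewrite l2normZ nc vE mulVf.
have -> : opmx_apply X (\col_i (c *: v i 0)) = \col_i (c *: opmx_apply X v i 0).
  apply/matrixP => i k; rewrite !mxE scaler_sumr; apply: eq_bigr => l _.
  by rewrite mxE linearZ.
by rewrite l2normZ nc vE mulrC ler_pdivrMr.
Qed.

Lemma opmxnorm_le m n (X : 'M['B(H)]_(m, n)) (M : R) : 0 <= M ->
  (forall v, l2norm (opmx_apply X v) <= M * l2norm v) -> opmxnorm X <= M.
Proof.
move=> M0 XM; apply: ge_sup => [|_ [v /= v1 <-]].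
  exists (l2norm (opmx_apply X (\col_i 0))), (\col_i 0) => //=.
  by rewrite l2norm0.
by apply: le_trans (XM v) _; rewrite ler_piMr.
Qed.

Lemma opmxnorm_ge0 m n (X : 'M['B(H)]_(m, n)) : 0 <= opmxnorm X.
Proof.
have [C C0 XC] := opmx_bounded X.
apply: (le_trans (l2norm_ge0 (opmx_apply X (\col_i 0)))).
apply: sup_upper_bound; last by exists (\col_i 0) => //=; rewrite l2norm0.
split; first by exists (l2norm (opmx_apply X (\col_i 0))), (\col_i 0) => //=;
  rewrite l2norm0.
by exists C => _ [w /= w1 <-]; apply: le_trans (XC w) _; rewrite ler_piMr.
Qed.

Variable A : submodClosed 'B(H).

Lemma submxnorm_ge0 m n (X : 'M[A]_(m, n)) : 0 <= submxnorm X.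
Proof. exact: opmxnorm_ge0. Qed.

Lemma le_col_submxnorm n (z : 'cV[A]_n) (v : H) :
  \sum_i rnorm (val (z i 0) v) ^+ 2 <= submxnorm z ^+ 2 * rnorm v ^+ 2.
Proof.
have := le_opmxnorm (map_mx val z) (\col_i v).
rewrite l2norm1 l2norm_le ?mulr_ge0 ?rnorm_ge0 ?submxnorm_ge0// -exprMn.
move/(le_trans _); apply; apply: ler_sum => i _.
by rewrite !mxE big_ord1 !mxE.
Qed.

Lemma col_submxnorm_le n (z : 'cV[A]_n) (M : R) : 0 <= M ->
  (forall v : H, \sum_i rnorm (val (z i 0) v) ^+ 2 <= M ^+ 2 * rnorm v ^+ 2) ->
  submxnorm z <= M.
Proof.
move=> M0 zM; apply: opmxnorm_le => // v.
have -> : v = \col_i v 0 0 by apply/matrixP => i k; rewrite mxE !ord1.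
rewrite l2norm1 l2norm_le ?mulr_ge0 ?rnorm_ge0// exprMn.
apply: le_trans (zM (v 0 0)); apply: ler_sum => i _.
by rewrite !mxE big_ord1 !mxE.
Qed.

End OperatorMatrices.

Section WhDual.
Variables (R : realType) (H : hilbertType R) (A : submodClosed 'B(H)).
Variable T : {biscalar A}.
Implicit Types x y : A.

Lemma biscalarDl x x' y : T (x + x') y = T x y + T x' y.
Proof. exact: linearDl. Qed.

Lemma biscalarDr x y y' : T x (y + y') = T x y + T x y'.
Proof. exact: linearDr. Qed.

Lemma biscalarZl a x y : T (a *: x) y = a * T x y.
Proof. exact: linearZl_LR. Qed.

Lemma biscalarZr a x y : T x (a *: y) = a * T x y.
Proof. exact: linearZr_LR. Qed.

Lemma tensor_eq_form (s t : seq (A * A)) : tensor_eq s t ->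
  \sum_(xy <- s) T xy.1 xy.2 = \sum_(xy <- t) T xy.1 xy.2.
Proof.
elim=> {s t} //.
- by move=> s t r _ -> _ ->.
- by move=> s s' t t' _ es _ et; rewrite !big_cat es et.
- by move=> s t; rewrite !big_cat /= addrC.
- by move=> y; rewrite big_seq1 big_nil; exact: linear0l.
- by move=> x x' y; rewrite !big_cons !big_nil !addr0 biscalarDl.
- by move=> x y y'; rewrite !big_cons !big_nil !addr0 biscalarDr.
- by move=> a x y; rewrite !big_seq1 biscalarZl biscalarZr.
Qed.

Lemma tensor_form_sum n (x y : 'cV[A]_n) :
  tensor_form T (tensor_sum x y) = \sum_i T (x i 0) (y i 0).
Proof.
rewrite /tensor_form /tensor_sum.
pose s := [seq (x i 0, y i 0) | i : 'I_n]; rewrite -/s.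
have /eqmodP/asboolP/tensor_eq_form -> :
  repr (\pi_(tensor A A) s)%qT = s %[mod tensor A A]%qT by rewrite reprK.
by rewrite big_map big_enum.
Qed.

Lemma tensor_sum_surj (u : tensor A A) :
  exists n (x y : 'cV[A]_n), u = tensor_sum x y.
Proof.
pose s := repr u; exists (size s).
exists (\col_i (tnth (in_tuple s) i).1), (\col_i (tnth (in_tuple s) i).2).
rewrite -[LHS]reprK /tensor_sum; congr (\pi_(tensor A A) _)%qT.
rewrite -[LHS]/(tval (in_tuple s)) -[LHS]map_tnth_enum.
by apply: eq_map => i; rewrite !mxE -surjective_pairing.
Qed.

Let whset (u : tensor A A) := [set z : R | exists n (x y : 'cV[A]_n),
  u = tensor_sum x y /\ z = 2^-1 * submxnorm (col_mx x y) ^+ 2].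

Let has_inf_whset u : has_inf (whset u).
Proof.
split; last by exists 0 => _ [n [x [y [_ ->]]]]; rewrite mulr_ge0// sqr_ge0.
have [n [x [y uxy]]] := tensor_sum_surj u.
by exists (2^-1 * submxnorm (col_mx x y) ^+ 2), n, x, y.
Qed.

Lemma whnorm_le n (x y : 'cV[A]_n) :
  whnorm (tensor_sum x y) <= 2^-1 * submxnorm (col_mx x y) ^+ 2.
Proof.
by apply: inf_lbound; [have [] := has_inf_whset (tensor_sum x y) | exists n, x,
  y].
Qed.

Lemma le_whnorm u (b : R) :
  (forall n (x y : 'cV[A]_n), u = tensor_sum x y ->
     b <= 2^-1 * submxnorm (col_mx x y) ^+ 2) -> b <= whnorm u.
Proof.
move=> ub; apply: lb_le_inf; first by have [] := has_inf_whset u.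
by move=> _ [n [x [y [uxy ->]]]]; exact: ub.
Qed.

(** Scaling both tensor factors by the same positive number turns the bound on
    the unit ball into a homogeneous one; the inequality is then written
    without matrix norms, as needed to build a sublinear functional from it. *)
Lemma whdual_sum_le n (x y : 'cV[A]_n) (M : R) : (whdualnorm T <= 1)%E ->
  0 <= M ->
  (forall v : H, \sum_i rnorm (val (x i 0) v) ^+ 2 +
     \sum_i rnorm (val (y i 0) v) ^+ 2 <= 2 * M * rnorm v ^+ 2) ->
  rnorm (\sum_i T (x i 0) (y i 0)) <= M.
Proof.
move=> T1 M0 xyM; apply/(@ler_addgt0Pr R) => e e0.
have Me : 0 < M + e by rewrite ltr_wpDl.
pose r := Num.sqrt (M + e)^-1.
have rr : r ^+ 2 = (M + e)^-1 by rewrite sqr_sqrtr ?invr_ge0 ?ltW.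
have r0 : 0 <= r by rewrite sqrtr_ge0.
pose sc (z : 'cV[A]_n) : 'cV[A]_n := \col_i (r%:C%C *: z i 0).
have scE (z : 'cV[A]_n) (v : H) : \sum_i rnorm (val (sc z i 0) v) ^+ 2 =
    r ^+ 2 * \sum_i rnorm (val (z i 0) v) ^+ 2.
  rewrite mulr_sumr; apply: eq_bigr => i _.
  have -> : sc z i 0 = r%:C%C *: z i 0 by rewrite mxE.
  by rewrite sub_valZ bopZ rnormZ exprMn rnorm_realC ger0_norm.
have wh1 : whnorm (tensor_sum (sc x) (sc y)) <= 1.
  rewrite (le_trans (whnorm_le _ _))//.
  have : submxnorm (col_mx (sc x) (sc y)) <= Num.sqrt 2.
    apply: col_submxnorm_le => [|v]; first exact: sqrtr_ge0.
    rewrite sqr_sqrtr// big_split_ord /=.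
    under eq_bigr do rewrite col_mxEu.
    under [X in _ + X]eq_bigr do rewrite col_mxEd.
    rewrite !scE -mulrDr rr ler_pdivrMl//.
    rewrite (le_trans (xyM v))//.
    have w0 : 0 <= rnorm v ^+ 2 by exact: sqr_ge0.
    by have := mulr_ge0 (ltW e0) w0; lra.
  rewrite -(@ler_pXn2r _ 2%N) ?nnegrE ?submxnorm_ge0 ?sqrtr_ge0// sqr_sqrtr//;
    lra.
have : ((rnorm (tensor_form T (tensor_sum (sc x) (sc y))))%:E <= 1)%E.
  by apply: le_trans T1; apply: ereal_sup_ubound;
    exists (tensor_sum (sc x) (sc y)).
rewrite lee_fin tensor_form_sum.
have -> : \sum_i T (sc x i 0) (sc y i 0) =
  (r ^+ 2)%:C%C * \sum_i T (x i 0) (y i 0).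
  rewrite mulr_sumr; apply: eq_bigr => i _.
  by rewrite !mxE biscalarZl biscalarZr mulrA -rmorphM expr2.
rewrite rnormM rnorm_realC ger0_norm ?sqr_ge0// rr.
by rewrite ler_pdivrMl// mulr1.
Qed.

(** If T is dominated by a product of two equal seminorms whose squares are
    summable against columns, the arithmetic-geometric mean inequality bounds
    its dual norm. *)
Lemma whdual_le1 (alpha : A -> R) : (forall x, 0 <= alpha x) ->
  (forall x y, rnorm (T x y) <= alpha x * alpha y) ->
  (forall n (z : 'cV[A]_n), \sum_i alpha (z i 0) ^+ 2 <= submxnorm z ^+ 2) ->
  (whdualnorm T <= 1)%E.
Proof.
move=> al0 Tal alz; apply: ge_ereal_sup => _ [u /= u1 <-]; rewrite lee_fin.
apply: le_trans u1; apply: le_whnorm => n x y ->; rewrite tensor_form_sum.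
apply: le_trans (_ : 2^-1 * \sum_i alpha (col_mx x y i 0) ^+ 2 <= _);
  last first.
  by rewrite ler_wpM2l ?alz ?invr_ge0.
rewrite big_split_ord /= mulrDr !mulr_sumr -big_split /=.
rewrite (le_trans (ler_rnorm_sum _ _))//; apply: ler_sum => i _;
  rewrite col_mxEu col_mxEd (le_trans (Tal _ _))//.
have := sqr_ge0 (alpha (x i 0) - alpha (y i 0)); lra.
Qed.

End WhDual.

(** * A dominating state on B(H) *)

Section DominatingState.
Variables (R : realType) (H : hilbertType R) (A : submodClosed 'B(H)).
Variables (T : {biscalar A}) (v0 : H).
Hypothesis v01 : rnorm v0 = 1.
Hypothesis T1 : (whdualnorm T <= 1)%E.
Implicit Types (c d : 'B(H)) (s : seq (A * A)).

Definition numerical_sup c : R :=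
  sup [set complex.Re (inner (c v) v) | v in [set v : H | rnorm v = 1]].

Let has_sup_numerical c :
  has_sup [set complex.Re (inner (c v) v) | v in [set v : H | rnorm v = 1]].
Proof.
split; first by exists (complex.Re (inner (c v0) v0)), v0.
exists (opnorm c) => _ [v /= v1 <-].
rewrite (le_trans (Re_le_rnorm _))// (le_trans (Cauchy_Schwarz _ _))//.
by rewrite v1 mulr1 (le_trans (le_opnorm _ _))// v1 mulr1.
Qed.

Lemma numerical_sup_ub c v : rnorm v = 1 ->
  complex.Re (inner (c v) v) <= numerical_sup c.
Proof. by move=> v1; apply: sup_upper_bound => //; exists v. Qed.

Lemma numerical_sup_le c (M : R) :
  (forall v, rnorm v = 1 -> complex.Re (inner (c v) v) <= M) ->
  numerical_sup c <= M.
Proof.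
by move=> cM; apply: ge_sup => [|_ [v /= v1 <-]];
  [have [] := has_sup_numerical c | exact: cM].
Qed.

Lemma numerical_supD c d :
  numerical_sup (c + d) <= numerical_sup c + numerical_sup d.
Proof.
apply: numerical_sup_le => v v1.
by rewrite bopD innerDl ReD lerD ?numerical_sup_ub.
Qed.

Lemma numerical_supZ (t : R) c : 0 <= t ->
  numerical_sup (t%:C%C *: c) <= t * numerical_sup c.
Proof.
move=> t0; apply: numerical_sup_le => v v1.
by rewrite bopZ innerZl ReZ ler_wpM2l ?numerical_sup_ub.
Qed.

(** A list of pairs stands for the element sum x (x) y of the algebraic tensor
    product, its concatenation for addition; gram is the operator whose norm
    is the squared norm of the column of all the x and y. *)
Definition gram s : 'B(H) := \sum_(xy <- s)
  (opmul (opadj (val xy.1)) (val xy.1) + opmul (opadj (val xy.2)) (val xy.2)).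

Definition form_sum s : R[i] := \sum_(xy <- s) T xy.1 xy.2.

Lemma inner_gram s (v : H) : complex.Re (inner (gram s v) v) =
  \sum_(xy <- s) (rnorm (val xy.1 v) ^+ 2 + rnorm (val xy.2 v) ^+ 2).
Proof.
elim: s => [|xy s IH]; first by rewrite /gram !big_nil inner0l.
rewrite /gram !big_cons bopD innerDl ReD -/(gram s) IH; congr (_ + _).
by rewrite bopD innerDl ReD !inner_adjmul.
Qed.

Lemma form_sum_le s : 2 * complex.Re (form_sum s) <= numerical_sup (gram s).
Proof.
pose x := \col_i (tnth (in_tuple s) i).1;
  pose y := \col_i (tnth (in_tuple s) i).2.
have -> : form_sum s = \sum_i T (x i 0) (y i 0).
  by rewrite /form_sum big_tnth; apply: eq_bigr => i _; rewrite !mxE.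
rewrite mulrC -ler_pdivlMr//; apply: (le_trans (Re_le_rnorm _)).
have gram_ge0 v : 0 <= complex.Re (inner (gram s v) v).
  by rewrite inner_gram sumr_ge0// => i _; rewrite addr_ge0 ?sqr_ge0.
apply: whdual_sum_le => // [|v].
  by rewrite divr_ge0// (le_trans (gram_ge0 v0))// numerical_sup_ub.
rewrite (mulrC 2) divfK//.
have -> : \sum_i rnorm (val (x i 0) v) ^+ 2 + \sum_i rnorm (val (y i 0) v) ^+ 2
  =
    complex.Re (inner (gram s v) v).
  rewrite inner_gram [RHS]big_tnth -big_split; apply: eq_bigr => i _.
  by rewrite !mxE.
have [->|v_neq0] := eqVneq v 0; first by rewrite inner0r rnorm0 expr0n mulr0.
have nv : 0 < rnorm v by rewrite rnorm_gt0 v_neq0.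
pose r := (rnorm v)^-1; have u1 : rnorm (r%:C%C *: v) = 1.
  exact: rnorm_normalize.
have := numerical_sup_ub (gram s) u1.
have -> : gram s (r%:C%C *: v) = r%:C%C *: gram s v by exact: linearZ.
rewrite innerZl innerZr conj_realC !ReZ mulrA -expr2 exprVn.
by rewrite mulrC ler_pdivrMr ?exprn_gt0.
Qed.

(** Adding the convex cone of the constraints to the numerical supremum gives
    a sublinear functional precisely because of the bound on T; a linear
    functional below it is numerically dominated and satisfies every
    constraint. *)
Let cone s c := numerical_sup (c + gram s) - 2 * complex.Re (form_sum s).

Let cone_lb c : exists b, forall s, b <= cone s c.
Proof.
exists (- numerical_sup (- c)) => s; rewrite /cone.
have := numerical_supD (- c) (c + gram s); rewrite addrA addNr add0r.
by have := form_sum_le s; lra.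
Qed.

Let cone_sublinear : sublinear (fun c => inf (range (cone^~ c))).
Proof.
apply: (sublinear_inf [::]) => [|s s' c c'|t s c t0].
- exact: cone_lb.
- exists (s ++ s'); rewrite /cone /form_sum /gram !big_cat /= -/(gram s)
    -/(gram s').
  rewrite addrACA ReD -/(form_sum s) -/(form_sum s').
  by have := numerical_supD (c + gram s) (c' + gram s'); lra.
- pose r := (Num.sqrt t)%:C%C : R[i].
  have rr : r * r = t%:C%C by rewrite -rmorphM -expr2 sqr_sqrtr// ltW.
  have rJ : r^* = r by exact: conj_realC.
  exists [seq (r *: xy.1, r *: xy.2) | xy <- s]; rewrite /cone.
  have -> : gram [seq (r *: xy.1, r *: xy.2) | xy <- s] = t%:C%C *: gram s.
    rewrite /gram big_map scaler_sumr; apply: eq_bigr => xy _ /=.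
    have scE (x : A) : opmul (opadj (val (r *: x))) (val (r *: x)) =
        t%:C%C *: opmul (opadj (val x)) (val x).
      by rewrite sub_valZ opmul_adjZ -mulc_conj rJ rr.
    by rewrite !scE scalerDr.
  have -> : form_sum [seq (r *: xy.1, r *: xy.2) | xy <- s] =
    t%:C%C * form_sum s.
    rewrite /form_sum big_map mulr_sumr; apply: eq_bigr => xy _ /=.
    by rewrite biscalarZl biscalarZr mulrA rr.
  rewrite -scalerDr ReZ.
  by have := numerical_supZ (c + gram s) (ltW t0); lra.
Qed.

Theorem dominating_state : exists p : {scalar 'B(H)},
  numerically_dominated p /\
  forall x y : A, rnorm (T x y) ^+ 2 <=
    complex.Re (p (opmul (opadj (val x)) (val x))) *
    complex.Re (p (opmul (opadj (val y)) (val y))).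
Proof.
have [p pq] := hahn_banach cone_sublinear.
have pcone c s : complex.Re (p c) <= cone s c.
  by rewrite (le_trans (pq c))// (inf_family_le [::] (cone_lb c)).
have pN : numerically_dominated p.
  move=> c M cM; apply: le_trans (pcone c [::]) _.
  by rewrite /cone /gram /form_sum !big_nil addr0 /= mulr0 subr0
    numerical_sup_le.
exists p; split=> // x y.
have p_ge0 (z : A) : 0 <= complex.Re (p (opmul (opadj (val z)) (val z))).
  by apply: (dominated_ge0 pN) => v; rewrite inner_adjmul /= sqr_ge0.
(* The constraint for (a x, y), with a arbitrary, is a quadratic bound. *)
apply: quadratic_bound => // a.
have := pcone (- gram [:: (a *: x, y)]) [:: (a *: x, y)].
rewrite /cone addNr /gram /form_sum !big_seq1 /= raddfN /= ReN biscalarZl.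
have N0 : numerical_sup 0 <= 0 by apply: numerical_sup_le => v _;
  rewrite inner0l.
have -> : opmul (opadj (val (a *: x))) (val (a *: x)) =
    (rnorm a ^+ 2)%:C%C *: opmul (opadj (val x)) (val x).
  by rewrite sub_valZ opmul_adjZ.
have -> (c d : 'B(H)) : p (c + d) = p c + p d by exact: raddfD.
have -> b (c : 'B(H)) : p (b *: c) = b * p c by exact: linearZ_LR.
rewrite ReD ReZ; lra.
Qed.

End DominatingState.

(** * States on the generated C*-algebra *)

Section States.
Variables (R : realType) (H : hilbertType R) (A : submodClosed 'B(H)).
Implicit Types (x y : cstar A).

Lemma state_bound (p : {scalar cstar A}) x : is_state p ->
  rnorm (p x) <= opnorm (val x).
Proof.
move=> [_ p1]; have pZ a y : p (a *: y) = a * p y by exact: linearZ_LR.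
have p_ball y : opnorm (val y) <= 1 -> rnorm (p y) <= 1.
  by move=> y1; rewrite -lee_fin -p1; apply: ereal_sup_ubound; exists y.
apply/(@ler_addgt0Pr R) => e e0.
have Me : 0 < opnorm (val x) + e by rewrite ltr_wpDl ?opnorm_ge0.
pose r : R := (opnorm (val x) + e)^-1; have r0 : 0 <= r by rewrite invr_ge0 ltW.
have := p_ball (r%:C%C *: x); rewrite pZ rnormM rnorm_realC ger0_norm//.
rewrite /r ler_pdivrMl// mulr1; apply.
apply: opnorm_le => // u.
rewrite sub_valZ bopZ rnormZ rnorm_realC ger0_norm// ler_pdivrMl// mul1r.
rewrite (le_trans (le_opnorm _ _))// ler_wpM2r ?rnorm_ge0// lerDl ltW//.
Qed.

(** Dividing a nonzero positive functional of norm at most one by its norm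
    can only increase it on positive elements. *)
Lemma normalized_state (phi : {scalar cstar A}) :
  (forall x, 0 <= phi (cstar_mul (cstar_adj x) x)) ->
  (forall x, rnorm (phi x) <= opnorm (val x)) ->
  (exists x, phi x != 0) ->
  exists p : {scalar cstar A}, is_state p /\
    forall x, phi (cstar_mul (cstar_adj x) x) <= p (cstar_mul (cstar_adj x) x).
Proof.
move=> phi_ge0 phi_le [x0 phix0].
have phiZ a y : phi (a *: y) = a * phi y by exact: linearZ_LR.
pose B := [set rnorm (phi x) | x in [set x : cstar A | opnorm (val x) <= 1]].
have B1 x : opnorm (val x) <= 1 -> rnorm (phi x) <= 1
  by apply: le_trans (phi_le x).
have scaled (r : R) x : 0 <= r -> opnorm (val (r%:C%C *: x)) <=
  r * opnorm (val x).
  move=> r0; apply: opnorm_le => [|u]; first by rewrite mulr_ge0 ?opnorm_ge0.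
  by rewrite sub_valZ bopZ rnormZ rnorm_realC ger0_norm//
    -mulrA ler_wpM2l ?le_opnorm.
have supB : has_sup B.
  split; last by exists 1 => _ [x /= x1 <-]; exact: B1.
  exists (rnorm (phi 0)), 0 => //=.
  by apply: opnorm_le => // u; rewrite mul1r;
    have -> : val (0 : cstar A) u = 0 by []; rewrite rnorm0 rnorm_ge0.
pose m := sup B.
have m1 : m <= 1 by apply: ge_sup => [|_ [x /= x1 <-]];
  [have [] := supB | exact: B1].
have m_ub x : opnorm (val x) <= 1 -> rnorm (phi x) <= m.
  by move=> x1; apply: sup_upper_bound => //; exists x.
have m0 : 0 < m.
  have n0 : 0 < opnorm (val x0).
    by apply: lt_le_trans (phi_le x0); rewrite rnorm_gt0 phix0.
  pose r : R := (opnorm (val x0))^-1; have r0 : 0 < r by rewrite invr_gt0.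
  apply: lt_le_trans (m_ub (r%:C%C *: x0) _).
    rewrite phiZ rnormM rnorm_realC ger0_norm ?ltW// mulr_gt0//.
    by rewrite rnorm_gt0 phix0.
  by rewrite (le_trans (scaled _ _ (ltW r0)))// mulVf ?gt_eqF.
have mi : 0 <= m^-1 by rewrite invr_ge0 ltW.
have [p pE] : exists p : {scalar cstar A}, forall x, p x = (m^-1)%:C%C * phi x.
  by apply: ex_scalar => a x y; rewrite linearP; ring.
have pphi x : phi (cstar_mul (cstar_adj x) x) <= p (cstar_mul (cstar_adj x) x).
  rewrite pE (ge0_complexE (phi_ge0 x)) -rmorphM lecR ler_peMl ?ge0_Re//.
  by rewrite invf_ge1.
exists p; split=> //; split=> [x|]; first exact: le_trans (phi_ge0 x) (pphi x).
have rp x : rnorm (p x) = m^-1 * rnorm (phi x).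
  by rewrite pE rnormM rnorm_realC ger0_norm.
apply/le_anti/andP; split.
  apply: ge_ereal_sup => _ [x /= x1 <-].
  by rewrite lee_fin rp ler_pdivrMl// mulr1 m_ub.
apply/lee_addgt0Pr => e e0; have me0 : 0 < m * e by rewrite mulr_gt0.
have [_ [x /= x1 <-] xm] := sup_adherent me0 supB.
apply: le_trans (_ : ((rnorm (p x))%:E + e%:E <= _)%E); last first.
  by rewrite leeD2r//; apply: ereal_sup_ubound; exists x.
rewrite -EFinD lee_fin rp -lerBlDr ler_pdivlMl// mulrBr mulr1.
by rewrite -/m in xm; exact: ltW.
Qed.

End States.

Section DominatedFunctional.
Variables (R : realType) (H : hilbertType R) (A : submodClosed 'B(H)).
Variable p : {scalar 'B(H)}.
Hypothesis pN : numerically_dominated p.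
Implicit Types x c : 'B(H).

Lemma dominated_sqr_ge0 x : 0 <= p (opmul (opadj x) x).
Proof.
have := gns_ge0 pN x; have := gns_herm pN x x; rewrite /gns_fun.
case: (p _) => a b /(congr1 (@complex.Im R)) /= b0 a0.
by rewrite lecE /= a0 andbT; apply/eqP; lra.
Qed.

(** Multiplying c by the conjugate of p c makes its value real without changing
    the bound on the numerical range. *)
Lemma dominated_norm c : rnorm (p c) <= opnorm c.
Proof.
have pZ a d : p (a *: d) = a * p d by exact: linearZ_LR.
have [pc0|pc0] := eqVneq (p c) 0; first by rewrite pc0 rnorm0 opnorm_ge0.
have n0 : 0 < rnorm (p c) by rewrite rnorm_gt0 pc0.
rewrite -(ler_pM2l n0) -expr2.
have -> : rnorm (p c) ^+ 2 = complex.Re (p ((p c)^* *: c)).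
  by rewrite pZ mulrC mulc_conj.
apply: pN => v v1; rewrite bopZ innerZl.
rewrite (le_trans (Re_le_rnorm _))// rnormM rnorm_conj ler_wpM2l ?rnorm_ge0//.
rewrite (le_trans (Cauchy_Schwarz _ _))// v1 mulr1.
by rewrite (le_trans (le_opnorm _ _))// v1 mulr1.
Qed.

End DominatedFunctional.

Section StateDomination.
Variables (R : realType) (H : hilbertType R) (A : submodClosed 'B(H)).

Lemma unit_vector (c : 'B(H)) : c != 0 ->
  exists2 v : H, rnorm v = 1 & c v != 0.
Proof.
move=> c0; have [v cv] : exists v, c v != 0.
  apply/not_existsP => cz; case/negP: c0; apply/eqP/bop_ext => v.
  by apply/eqP/negPn/negP; exact: cz.
have v0 : v != 0 by apply: contraNneq cv => ->; rewrite linear0.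
have nv : 0 < rnorm v by rewrite rnorm_gt0 v0.
pose r := (rnorm v)^-1; have r0 : 0 <= r by rewrite invr_ge0 ltW.
exists (r%:C%C *: v); first exact: rnorm_normalize.
have -> : c (r%:C%C *: v) = r%:C%C *: c v by exact: linearZ.
rewrite -rnorm_eq0 rnormZ rnorm_realC ger0_norm// mulf_neq0 ?rnorm_eq0//.
by rewrite invr_neq0 ?gt_eqF.
Qed.

(** The restriction to C*(A) of a dominated functional may vanish, in which
    case a vector state does as well. *)
Lemma dominating_cstar_state (p : {scalar 'B(H)}) :
  (exists x : A, x != 0) -> numerically_dominated p ->
  exists p0 : {scalar cstar A}, is_state p0 /\ forall x : cstar A,
    p (opmul (opadj (val x)) (val x)) <= p0 (cstar_mul (cstar_adj x) x).
Proof.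
move=> [a a0] pN.
have [phi phiE] : exists phi : {scalar cstar A}, forall x, phi x = p (val x).
  by apply: ex_scalar => b x y; rewrite sub_valD sub_valZ linearP.
have [phi0|phi0] := pselect (exists x, phi x != 0).
  have [x|x|//|p0 [p0s p0phi]] := @normalized_state _ _ _ phi.
  - by rewrite phiE dominated_sqr_ge0.
  - by rewrite phiE dominated_norm.
  by exists p0; split=> // x; apply: le_trans (p0phi x); rewrite phiE.
have [|v v1 av] := @unit_vector (val a); first by [].
have [psi psiE] : exists psi : {scalar cstar A},
    forall x, psi x = inner (val x v) v.
  by apply: ex_scalar => b x y;
    rewrite sub_valD sub_valZ bopD bopZ innerDl innerZl.
have psi_sqr x : psi (cstar_mul (cstar_adj x) x) = (rnorm (val x v) ^+ 2)%:C%C.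
  by rewrite psiE -inner_adjmul.
have [x|x||p0 [p0s p0psi]] := @normalized_state _ _ _ psi.
- by rewrite psi_sqr lecR sqr_ge0.
- rewrite psiE (le_trans (Cauchy_Schwarz _ _))// v1 mulr1.
  by rewrite (le_trans (le_opnorm _ _))// v1 mulr1.
- exists (cstar_mul (cstar_adj (cstar_incl a)) (cstar_incl a)).
  rewrite psi_sqr -rnorm_eq0 rnorm_realC ger0_norm ?sqr_ge0// sqrf_eq0.
  by rewrite rnorm_eq0.
exists p0; split=> // x; apply: le_trans (p0psi x).
rewrite psi_sqr; have -> : p (opmul (opadj (val x)) (val x)) = 0.
  have /eqP := (phiE (cstar_mul (cstar_adj x) x)); rewrite eq_sym => /eqP ->.
  by apply/eqP/negPn/negP => n0; apply: phi0;
    exists (cstar_mul (cstar_adj x) x).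
by rewrite lecR sqr_ge0.
Qed.

Lemma whdual_state (T : {biscalar A}) : (exists x : A, x != 0) ->
  (whdualnorm T <= 1)%E ->
  exists p0 : {scalar cstar A}, is_state p0 /\
    forall x y : A, `|T x y| <=
      sqrtC (p0 (cstar_mul (cstar_adj (cstar_incl x)) (cstar_incl x))) *
      sqrtC (p0 (cstar_mul (cstar_adj (cstar_incl y)) (cstar_incl y))).
Proof.
move=> A0 T1; have [a a0] := A0.
have [|v v1 _] := @unit_vector (val a); first by [].
have [p [pN Tp]] := dominating_state v1 T1.
have [p0 [p0s pp0]] := dominating_cstar_state A0 pN.
exists p0; split=> // x y.
have p_ge0 (z : cstar A) : 0 <= p (opmul (opadj (val z)) (val z))
  by exact: dominated_sqr_ge0.
have p0_ge0 z : 0 <= p0 (cstar_mul (cstar_adj z) z) by have [+ _] := p0s; exact.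
rewrite -sqrtCM ?nnegrE// -(sqrCK (normr_ge0 (T x y))) ler_sqrtC ?nnegrE
  ?sqr_ge0 ?mulr_ge0//.
apply: le_trans (ler_pM _ _ (pp0 (cstar_incl x)) (pp0 (cstar_incl y))) => //.
rewrite (ge0_complexE (p_ge0 (cstar_incl x))) (ge0_complexE (p_ge0 (cstar_incl
  y))).
by rewrite rnormE -rmorphXn -rmorphM lecR; exact: Tp.
Qed.

End StateDomination.

(** * Representations and the contraction b *)

Section GramOperator.
Variables (R : realType) (H : hilbertType R).

(** The bound on the quadratic form of a positive operator extends to its
    sesquilinear form by Cauchy-Schwarz, hence bounds its norm. *)
Lemma opnorm_gram n (z : 'I_n -> 'B(H)) (C : R) : 0 <= C ->
  (forall v, \sum_i rnorm (z i v) ^+ 2 <= C * rnorm v ^+ 2) ->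
  opnorm (\sum_i opmul (opadj (z i)) (z i)) <= C.
Proof.
move=> C0 zC; set d := \sum_i _; apply: opnorm_le => // v.
have dE u w : inner (d u) w = \sum_i inner (z i u) (z i w).
  rewrite bop_sum innerC inner_sumr rmorph_sum; apply: eq_bigr => i _ /=.
  by rewrite -innerC -opadjPr.
have dC u w : rnorm (inner (d u) w) ^+ 2 <=
  (C * rnorm u ^+ 2) * (C * rnorm w ^+ 2).
  apply: quadratic_bound => [|a]; first by rewrite mulr_ge0 ?sqr_ge0.
  rewrite dE mulr_sumr Re_sum mulr_sumr.
  apply: le_trans (_ : \sum_i (rnorm a ^+ 2 * rnorm (z i u) ^+ 2 +
      rnorm (z i w) ^+ 2) <= _).
    apply: ler_sum => i _; have := sqr_ge0 (rnorm (a *: z i u - z i w)).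
    by rewrite sqr_rnormB rnormZ exprMn innerZl; lra.
  by rewrite big_split /= -mulr_sumr lerD ?ler_wpM2l ?sqr_ge0.
have [->|dv0] := eqVneq (rnorm (d v)) 0; first by rewrite mulr_ge0 ?rnorm_ge0.
have n0 : 0 < rnorm (d v) by rewrite lt_def rnorm_ge0 dv0.
have := dC v (d v); rewrite inner_self rnorm_realC ger0_norm ?sqr_ge0//.
have -> : C * rnorm v ^+ 2 * (C * rnorm (d v) ^+ 2) =
    (C * rnorm v * rnorm (d v)) ^+ 2 by ring.
rewrite ler_pXn2r ?nnegrE ?mulr_ge0 ?sqr_ge0 ?rnorm_ge0//.
by rewrite expr2 ler_pM2r.
Qed.

Variable A : submodClosed 'B(H).

Definition cstar_gram n (z : 'cV[A]_n) : cstar A :=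
  \sum_i cstar_mul (cstar_adj (cstar_incl (z i 0))) (cstar_incl (z i 0)).

Lemma opnorm_cstar_gram n (z : 'cV[A]_n) :
  opnorm (val (cstar_gram z)) <= submxnorm z ^+ 2.
Proof.
rewrite sub_val_sum; apply: opnorm_gram => [|v]; first exact: sqr_ge0.
exact: le_col_submxnorm.
Qed.

(** A state is at most the norm on the Gram element of a column, and that norm
    is at most the squared column norm. *)
Lemma state_whdual (T : {biscalar A}) (p0 : {scalar cstar A}) :
  is_state p0 ->
  (forall x y : A, `|T x y| <=
      sqrtC (p0 (cstar_mul (cstar_adj (cstar_incl x)) (cstar_incl x))) *
      sqrtC (p0 (cstar_mul (cstar_adj (cstar_incl y)) (cstar_incl y)))) ->
  (whdualnorm T <= 1)%E.
Proof.
move=> p0s Tp0; have [p0_ge0 _] := p0s.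
pose sq (x : A) := cstar_mul (cstar_adj (cstar_incl x)) (cstar_incl x).
pose alpha (x : A) : R := Num.sqrt (complex.Re (p0 (sq x))).
have al2 x : alpha x ^+ 2 = complex.Re (p0 (sq x)).
  by rewrite sqr_sqrtr// ge0_Re// p0_ge0.
have alC x : sqrtC (p0 (sq x)) = (alpha x)%:C%C.
  apply: (@pexpIrn _ 2%N); rewrite ?nnegrE ?sqrtC_ge0 ?p0_ge0 ?lecR
    ?sqrtr_ge0//.
  by rewrite sqrtCK -rmorphXn /= al2 -ge0_complexE ?p0_ge0.
apply: (@whdual_le1 _ _ _ _ alpha) => [x|x y|n z]; first exact: sqrtr_ge0.
  by have := Tp0 x y; rewrite -/(sq x) -/(sq y) !alC rnormE -rmorphM lecR.
apply: le_trans (opnorm_cstar_gram z); apply: le_trans (state_bound _ p0s).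
apply: le_trans (Re_le_rnorm _); rewrite /cstar_gram raddf_sum Re_sum.
by apply: ler_sum => i _; rewrite al2.
Qed.

End GramOperator.

Section Representation.
Variables (R : realType) (V : lmodType R[i]) (K : hilbertType R).
Variables (j : {linear V -> K}) (T : V -> V -> R[i]).
Hypothesis T_linl : forall y, scalar (T^~ y).
Hypothesis T_linr : forall x, scalar (T x).
Hypothesis T_le : forall x y, rnorm (T x y) <= rnorm (j x) * rnorm (j y).

Let c x : K := riesz j (T x).

Let cP x : represents j (T x) (c x).
Proof. exact: rieszP (rnorm_ge0 _) (@T_linr x) (T_le x). Qed.

Let c_lin a x y : c (a *: x + y) = a^* *: c x + c y.
Proof.
apply: (represents_uniq (cP _)); have := represents_lin a (cP x) (cP y).
congr (represents j _ _); apply/funext => z; by rewrite (T_linl z).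
Qed.

Let d_fun (k : K) x : R[i] := inner k (c x).

Let d_scalar k : scalar (d_fun k).
Proof. by move=> a x y; rewrite /d_fun c_lin innerDr innerZr conjCK. Qed.

Let d_bound k x : rnorm (d_fun k x) <= rnorm k * rnorm (j x).
Proof.
rewrite (le_trans (Cauchy_Schwarz _ _))// ler_wpM2l ?rnorm_ge0//.
exact: rnorm_riesz (rnorm_ge0 _) (@T_linr x) (T_le x).
Qed.

(** Two applications of the Riesz theorem extend the form on the range of j:
    the first in the variable y, on the closure of the range of j, the second
    in the variable x, on K.  Being antilinear, the result is linear into the
    conjugate space. *)
Lemma contraction_of_form : exists b : bop K (conjugate K),
  opnorm b <= 1 /\ forall x y, T x y = inner (b (j y)) (bar (j x)).
Proof.
pose d (k : K) : conjugate K := bar (riesz j (d_fun k)).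
have dP (k : K) : represents j (d_fun k) (riesz j (d_fun k)).
  exact: rieszP (rnorm_ge0 k) (d_scalar k) (d_bound k).
have d_lin : linear d.
  move=> a k l; apply: (represents_uniq (dP _)).
  have := represents_lin a (dP k) (dP l).
  congr (represents j _ _); apply/funext => x.
  by rewrite /d_fun innerDl innerZl.
have d1 (k : K) : rnorm (d k) <= 1 * rnorm k.
  by rewrite mul1r; exact: rnorm_riesz (rnorm_ge0 k) (d_scalar k) (d_bound k).
exists (Bop (bounded_linearP d_lin d1)); split=> [|x y].
  exact: opnorm_le.
have -> : inner (Bop (bounded_linearP d_lin d1) (j y)) (bar (j x)) =
    inner (j x) (riesz j (d_fun (j y))) by [].
by have [<- _] := dP (j y); have [-> _] := cP x.
Qed.

End Representation.

Lemma whdual_representation (R : realType) (H : hilbertType R)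
    (A : submodClosed 'B(H)) (A_neq0 : exists x : A, x != 0)
    (T : {biscalar A}) : (whdualnorm T <= 1)%E ->
  exists (K : hilbertType R) (pi : {linear cstar A -> 'B(K)})
         (xi : K) (b : bop K (conjugate K)),
    [/\ is_star_rep pi, `|xi| = 1, opnorm b <= 1 &
        forall x y : A, T x y =
          inner (b (pi (cstar_incl y) xi)) (bar (pi (cstar_incl x) xi))].
Proof.
move=> T1; have [a a0] := A_neq0.
have [|v v1 _] := @unit_vector _ _ (val a); first by [].
have [p [pN Tp]] := dominating_state v1 T1.
have [K [pi [xi [piM pi_adj pip xi1]]]] := gns_representation pN.
have [rho rhoE] : exists rho :
  {linear cstar A -> 'B(K)}, forall x, rho x = pi (val x).
  by apply: ex_linear => b x y; rewrite sub_valD sub_valZ linearP.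
have [j jE] : exists j : {linear A -> K}, forall x, j x = pi (val x) xi.
  by apply: ex_linear => b x y; rewrite sub_valD sub_valZ linearP.
have nj x : rnorm (j x) ^+ 2 = complex.Re (p (opmul (opadj (val x)) (val x))).
  by rewrite jE -pip piM pi_adj /= -opadjPr inner_self.
have [x|x|x y|b [b1 bT]] := @contraction_of_form _ _ _ j T.
- by move=> e y z; rewrite biscalarDl biscalarZl.
- by move=> e y z; rewrite biscalarDr biscalarZr.
- rewrite -(@ler_pXn2r _ 2%N) ?nnegrE ?mulr_ge0 ?rnorm_ge0//.
  by rewrite exprMn !nj Tp.
exists K, rho, xi, b; split=> //.
- by split=> [x y|x]; rewrite !rhoE ?piM ?pi_adj.
- by rewrite rnormE xi1.
- by move=> x y; rewrite bT !jE !rhoE.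
Qed.

(** * Contractivity of *-representations *)

Section OperatorLimits.
Variables (R : realType) (H : hilbertType R).

(** The pointwise limits given by completeness of H assemble into an operator
    because the errors are uniform on the unit ball. *)
Lemma operator_limit I (X : I -> 'B(H)) (e : I -> R) :
  (forall i j v, rnorm (X i v - X j v) <= (e i + e j) * rnorm v) ->
  (forall d, 0 < d -> exists i, e i < d) ->
  exists Y : 'B(H), forall i v, rnorm (X i v - Y v) <= e i * rnorm v.
Proof.
move=> Xe e0.
have lim v : exists l, forall i, rnorm (X i v - l) <= e i * rnorm v.
  apply: family_limit => [i j|d d0]; first by rewrite -mulrDl.
  have [v0|v0] := eqVneq (rnorm v) 0.
    by have [i _] := e0 1 ltr01; exists i; rewrite v0 mulr0.
  have nv : 0 < rnorm v by rewrite lt_def rnorm_ge0 v0.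
  have [i ei] := e0 (d / rnorm v) (divr_gt0 d0 nv).
  by exists i; rewrite -ltr_pdivlMr.
have [f Xf] := choice lim.
have lf : linear f.
  move=> a u v; apply/eqP; rewrite -subr_eq0; apply/eqP/le_rnorm_eq0 => d d0.
  apply: (@le_small _ _ _ (rnorm (a *: u + v) + rnorm a * rnorm u + rnorm v)).
    by rewrite !addr_ge0 ?mulr_ge0 ?rnorm_ge0.
  move=> r /andP[r0 _]; have [i ei] := e0 r r0.
  have Xfr w : rnorm (X i w - f w) <= r * rnorm w.
    by rewrite (le_trans (Xf w i))// ler_wpM2r ?rnorm_ge0// ltW.
  have XD : X i (a *: u + v) = a *: X i u + X i v by exact: linearP.
  have -> : f (a *: u + v) - (a *: f u + f v) =
      - (X i (a *: u + v) - f (a *: u + v)) + (a *: (X i u - f u) + (X i v - f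
          v)).
    rewrite XD scalerBr; move: (a *: X i u) (X i v) (a *: f u) (f v) => x y z t.
    by rewrite opprB (addrACA x) -opprD [RHS]addrA subrK.
  rewrite (le_trans (ler_rnormD _ _))// rnormN.
  have := ler_rnormD (a *: (X i u - f u)) (X i v - f v); rewrite rnormZ.
  have := Xfr (a *: u + v); have := Xfr v;
    have := ler_wpM2l (rnorm_ge0 a) (Xfr u).
  lra.
have [i0 _] := e0 1 ltr01.
have fM v : rnorm (f v) <= (opnorm (X i0) + e i0) * rnorm v.
  have := ler_rdistD (X i0 v) (f v) 0; rewrite !subr0 rnormB mulrDl.
  by have := Xf v i0; have := le_opnorm (X i0) v; lra.
by exists (Bop (bounded_linearP lf fM)) => i v; exact: Xf.
Qed.

Lemma geometric_small (rho d : R) : 0 <= rho < 1 -> 0 < d ->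
  exists n, rho ^+ n / (1 - rho) < d.
Proof.
move=> /andP[rho0 rho1] d0.
have r1 : 0 < 1 - rho by rewrite subr_gt0.
have dr : 0 < d * (1 - rho) by rewrite mulr_gt0.
have : `|rho| < 1 by rewrite ger0_norm.
move=> /cvg_expr/cvgrPdist_lt/(_ _ dr)[n _ /(_ n (leqnn n))] /=.
rewrite sub0r normrN ger0_norm ?exprn_ge0// => rn.
by exists n; rewrite ltr_pdivrMr.
Qed.

(** The Neumann series of e without its constant term: 1 + w inverts 1 - e,
    and w stays in the algebra even if the algebra has no unit. *)
Lemma neumann_series (S : {pred 'B(H)}) (e : 'B(H)) (rho : R) :
  cstar_subalgebra S -> e \in S -> 0 <= rho < 1 ->
  (forall v, rnorm (e v) <= rho * rnorm v) ->
  exists2 w : 'B(H), w \in S & w = e + opmul w e.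
Proof.
move=> [[S0 Sl] Sm _ Sc] Se rho01 e_rho; have /andP[rho0 rho1] := rho01.
have r1 : 0 < 1 - rho by rewrite subr_gt0.
pose X n := iter n (fun x => e + opmul x e) (0 : 'B(H)).
pose delta n := rho ^+ n / (1 - rho).
have XS n : X n \in S.
  by elim: n => [//|n IH]; rewrite /= -[e]scale1r Sl// scale1r Sm.
have XSn n v : X n.+1 v = e v + X n (e v) by [].
have Xstep n v : rnorm (X n.+1 v - X n v) <= rho ^+ n * rnorm v.
  elim: n v => [v|n IH v].
    rewrite XSn /= !addr0 subr0 expr0 mul1r (le_trans (e_rho v))//.
    by rewrite ler_piMl ?rnorm_ge0 ?ltW.
  have -> : X n.+2 v - X n.+1 v = X n.+1 (e v) - X n (e v).
    by rewrite !XSn opprD addrACA subrr add0r.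
  by rewrite (le_trans (IH (e v)))// exprSr -mulrA ler_wpM2l ?exprn_ge0.
(* delta n bounds the tail of the geometric series, so it telescopes. *)
have deltaS n : rho ^+ n = delta n - delta n.+1.
  by rewrite /delta exprS; field; rewrite gt_eqF.
have delta_ge0 n : 0 <= delta n by rewrite divr_ge0 ?exprn_ge0 ?(ltW r1).
have Xk n k v : rnorm (X (k + n)%N v - X n v) <=
  (delta n - delta (k + n)%N) * rnorm v.
  elim: k => [|k IH]; first by rewrite !subrr rnorm0 mul0r.
  have := ler_rdistD (X (k + n)%N v) (X (k.+1 + n)%N v) (X n v).
  have := Xstep (k + n)%N v; rewrite deltaS addSn; lra.
have Xd m n v : rnorm (X m v - X n v) <= (delta m + delta n) * rnorm v.
  wlog nm : m n / (n <= m)%N.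
    move=> mn; have [nm|nm] := leqP n m; first exact: mn.
    by rewrite rnormB (addrC (delta m)) mn// ltnW.
  rewrite -(subnK nm) (le_trans (Xk _ _ _))// ler_wpM2r ?rnorm_ge0//.
  by have := delta_ge0 (m - n + n)%N; lra.
have [w Xw] := operator_limit Xd (fun d => geometric_small rho01).
exists w.
  apply: Sc => r r0; have [n nr] := geometric_small rho01 r0.
  exists (X n) => //; apply: le_lt_trans nr.
  apply: opnorm_le => [|v]; first exact: delta_ge0.
  by rewrite bopB rnormB.
apply: bop_ext => v; apply/eqP; rewrite -subr_eq0;
  apply/eqP/le_rnorm_eq0 => r r0.
apply: (@le_small _ _ _ (2 * rnorm v)); first by rewrite mulr_ge0 ?rnorm_ge0.
move=> s /andP[s0 _]; have [n ns] := geometric_small rho01 s0.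
have -> : w v - (e + opmul w e) v = (X n (e v) - w (e v)) - (X n.+1 v - w v).
  rewrite XSn bopD /=; move: (w v) (e v) (X n _) (w (e v)) => a b c d.
  by rewrite opprB [RHS]addrC !opprD !addrA subrK.
rewrite (le_trans (ler_rnormD _ _))// rnormN.
have := Xw n (e v); have := Xw n.+1 v.
have : delta n * rnorm (e v) <= delta n * rnorm v.
  by rewrite ler_wpM2l// (le_trans (e_rho v))// ler_piMl ?rnorm_ge0 ?ltW.
have : delta n.+1 * rnorm v <= delta n * rnorm v.
  by rewrite ler_wpM2r ?rnorm_ge0// -subr_ge0 -deltaS exprn_ge0.
have : delta n * rnorm v <= s * rnorm v by rewrite ler_wpM2r ?rnorm_ge0 ?ltW.
lra.
Qed.

Lemma rnorm_opadj (x : 'B(H)) v : rnorm (opadj x v) <= opnorm x * rnorm v.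
Proof.
have [->|n0] := eqVneq (rnorm (opadj x v)) 0.
  by rewrite mulr_ge0 ?opnorm_ge0 ?rnorm_ge0.
have n1 : 0 < rnorm (opadj x v) by rewrite lt_def rnorm_ge0 n0.
rewrite -(ler_pM2r n1) -expr2.
have -> : rnorm (opadj x v) ^+ 2 = complex.Re (inner (x (opadj x v)) v).
  by rewrite opadjP inner_self.
rewrite (le_trans (Re_le_rnorm _))// (le_trans (Cauchy_Schwarz _ _))// mulrAC.
by rewrite ler_wpM2r ?rnorm_ge0 ?le_opnorm.
Qed.

End OperatorLimits.

Section StarRepresentations.
Variables (R : realType) (H : hilbertType R) (A : submodClosed 'B(H)).
Variables (K : hilbertType R) (pi : {linear cstar A -> 'B(K)}).
Hypothesis pi_rep : is_star_rep pi.

(** If pi increased the norm of c, put s = |pi c| > |c| and e = c^* c / s^2.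
    Then 1 - e has a quasi-inverse in the algebra, so 1 - pi e is bounded
    below; but vectors that nearly attain the norm of pi c are approximate
    eigenvectors of pi e for the eigenvalue 1. *)
Lemma star_rep_contractive c : opnorm (pi c) <= opnorm (val c).
Proof.
have [piM pi_adj] := pi_rep.
rewrite leNgt; apply/negP; set N := opnorm (val c);
  set s := opnorm (pi c) => Ns.
have N0 : 0 <= N by exact: opnorm_ge0.
have s0 : 0 < s by exact: le_lt_trans Ns.
have si : 0 < s ^- 2 by rewrite invr_gt0 exprn_gt0.
pose e : cstar A := (s ^- 2)%:C%C *: cstar_mul (cstar_adj c) c.
have eE v : val e v = (s ^- 2)%:C%C *: opadj (val c) (val c v)
  by rewrite sub_valZ.
pose rho := s ^- 2 * N ^+ 2.
have rho01 : 0 <= rho < 1.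
  rewrite mulr_ge0 ?sqr_ge0 ?(ltW si)//= /rho mulrC ltr_pdivrMr ?exprn_gt0//
    mul1r.
  by rewrite ltr_pXn2r ?nnegrE ?(ltW s0).
have e_rho v : rnorm (val e v) <= rho * rnorm v.
  rewrite eE rnormZ rnorm_realC ger0_norm ?(ltW si)//
    -mulrA ler_wpM2l ?(ltW si)//.
  by rewrite (le_trans (rnorm_opadj _ _))// expr2 -mulrA ler_wpM2l// le_opnorm.
have [w Sw wE] := neumann_series (cstar_predP A) (valP e) rho01 e_rho.
pose w' : cstar A := exist _ w Sw.
have piw : pi w' = pi e + opmul (pi w') (pi e).
  by rewrite -piM -raddfD /=; congr (pi _); apply: val_inj.
have piE k : pi e k = (s ^- 2)%:C%C *: opadj (pi c) (pi c k).
  have -> : pi e = (s ^- 2)%:C%C *: opmul (opadj (pi c)) (pi c).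
    by rewrite /e linearZ /= piM pi_adj.
  by [].
pose C := 1 + opnorm (pi w').
have C1 : 1 <= C by rewrite lerDl opnorm_ge0.
(* k = (1 + pi w) (1 - pi e) k, so 1 - pi e is bounded below by 1 / C. *)
have below k : rnorm k <= C * rnorm (k - pi e k).
  have kE : k = (k - pi e k) + pi w' (k - pi e k).
    have -> : pi w' (k - pi e k) = pi w' k - pi w' (pi e k) by exact: raddfB.
    have -> : pi w' k = pi e k + pi w' (pi e k) by rewrite {1}piw.
    by rewrite addrK subrK.
  rewrite {1}kE (le_trans (ler_rnormD _ _))// mulrDl mul1r lerD2l.
  exact: le_opnorm.
(* The norm of pi e is at most 1 and (pi e k, k) = |pi c k|^2 / s^2. *)
have upper k : rnorm (k - pi e k) ^+ 2 <=
    2 * rnorm k ^+ 2 - 2 * (s ^- 2 * rnorm (pi c k) ^+ 2).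
  have nE : rnorm (pi e k) <= rnorm k.
    rewrite piE rnormZ rnorm_realC ger0_norm ?(ltW si)//.
    rewrite mulrC ler_pdivrMr ?exprn_gt0// (le_trans (rnorm_opadj _ _))//.
    by rewrite [leRHS]mulrC expr2 -mulrA ler_wpM2l ?(ltW s0)// le_opnorm.
  have nE2 : rnorm (pi e k) ^+ 2 <= rnorm k ^+ 2.
    by rewrite ler_pXn2r ?nnegrE ?rnorm_ge0.
  rewrite sqr_rnormB Re_innerC piE innerZl ReZ -opadjPr inner_self -piE /=.
  move: nE2; move: (rnorm (pi e k) ^+ 2) (rnorm k ^+ 2) (s ^- 2 * _) => x y z.
  lra.
(* Combining the two bounds keeps |pi c k| uniformly away from s |k|. *)
have sC k : rnorm (pi c k) ^+ 2 <=
  s ^+ 2 * (1 - (2 * C ^+ 2)^-1) * rnorm k ^+ 2.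
  have C20 : 0 < 2 * C ^+ 2 by rewrite mulr_gt0// exprn_gt0//
    (lt_le_trans ltr01).
  have ab : rnorm k ^+ 2 <=
      C ^+ 2 * (2 * rnorm k ^+ 2 - 2 * (s ^- 2 * rnorm (pi c k) ^+ 2)).
    apply: le_trans (ler_wpM2l (sqr_ge0 C) (upper k)).
    by rewrite -exprMn ler_pXn2r ?nnegrE ?mulr_ge0 ?rnorm_ge0 ?(le_trans ler01).
  have -> : s ^+ 2 * (1 - (2 * C ^+ 2)^-1) * rnorm k ^+ 2 =
     s ^+ 2 * (rnorm k ^+ 2 - (2 * C ^+ 2)^-1 * rnorm k ^+ 2) by ring.
  rewrite -ler_pdivrMl ?exprn_gt0//.
  move: (s ^- 2 * _) (rnorm k ^+ 2) ab => a b ab.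
  have : (2 * C ^+ 2)^-1 * b <= b - a.
    rewrite ler_pdivrMl//; apply: le_trans ab _.
    by rewrite -mulrBr mulrA (mulrC _ 2).
  lra.
have t_ge0 : 0 <= 1 - (2 * C ^+ 2)^-1.
  have : 1 <= C ^+ 2 by rewrite expr_ge1 ?(le_trans ler01).
  by move: (C ^+ 2) => q q1; rewrite subr_ge0 invf_le1; lra.
have : s <= s * Num.sqrt (1 - (2 * C ^+ 2)^-1).
  apply: opnorm_le => [|k]; first by rewrite mulr_ge0 ?sqrtr_ge0 ?(ltW s0).
  rewrite -(@ler_pXn2r _ 2%N) ?nnegrE ?mulr_ge0 ?rnorm_ge0 ?sqrtr_ge0 ?(ltW
    s0)//.
  by rewrite !exprMn sqr_sqrtr.
rewrite ler_pMr// => /(fun h => ler_pM ler01 ler01 h h).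
rewrite mul1r -expr2 sqr_sqrtr// lerBrDr gerDl leNgt invr_gt0.
by rewrite mulr_gt0// exprn_gt0// (lt_le_trans ltr01).
Qed.

End StarRepresentations.

(** * Completely bounded maps into the column Hilbert space *)

Section ColumnSpace.
Variables (R : realType) (H : hilbertType R) (A : submodClosed 'B(H)).
Variable K : hilbertType R.

Lemma le_colmxnorm n (X : 'M[K]_n) (l : 'cV[R[i]]_n) : l2norm l <= 1 ->
  l2norm (\col_i \sum_j l j 0 *: X i j) <= colmxnorm X.
Proof.
move=> l1; apply: sup_upper_bound; last by exists l.
split.
  exists (l2norm (\col_i \sum_j (\col_k 0 : 'cV[R[i]]_n) j 0 *: X i j)).
  by exists (\col_k 0) => //=; rewrite l2norm0.
pose c i := \sum_j rnorm (X i j).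
have c0 i : 0 <= c i by apply: sumr_ge0 => j _; exact: rnorm_ge0.
exists (\sum_i c i) => _ [k /= k1 <-].
rewrite l2norm_le ?sumr_ge0// expr2 mulr_suml; apply: ler_sum => i _.
apply: le_trans (_ : c i * c i <= _); last first.
  by rewrite ler_wpM2l// (bigD1 i)//= lerDl sumr_ge0.
rewrite -expr2 ler_pXn2r ?nnegrE ?rnorm_ge0// mxE.
rewrite (le_trans (ler_rnorm_sum _ _))//; apply: ler_sum => j _.
by rewrite rnormZ ler_piMl ?rnorm_ge0// (le_trans (le_l2norm _ _)).
Qed.

Lemma colmxnorm_ge0 n (X : 'M[K]_n) : 0 <= colmxnorm X.
Proof.
apply: le_trans (le_colmxnorm X (_ : l2norm (\col_k 0) <= 1)).
  exact: l2norm_ge0.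
by rewrite l2norm0.
Qed.

Lemma cbnorm_ub (a : A -> K) n (X : 'M[A]_n) : submxnorm X <= 1 ->
  ((colmxnorm (map_mx a X))%:E <= cbnorm a)%E.
Proof. by move=> X1; apply: ereal_sup_ubound; exists n, X. Qed.

Lemma cbnorm_ge0 (a : A -> K) : (0 <= cbnorm a)%E.
Proof.
pose X : 'M[A]_0 := \matrix_(i, j) 0.
apply: le_trans (_ : ((colmxnorm (map_mx a X))%:E <= _)%E).
  by rewrite lee_fin colmxnorm_ge0.
apply: cbnorm_ub; apply: opmxnorm_le => // v.
by rewrite mul1r /l2norm big_ord0 sqrtr0 sqrtr_ge0.
Qed.

(** A column is a square matrix whose other columns vanish, so that the
    completely bounded norm controls column norms as well. *)
Lemma cbnorm_column (a : {linear A -> K}) (c : R) : cbnorm a = c%:E ->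
  forall n (z : 'cV[A]_n),
    \sum_i rnorm (a (z i 0)) ^+ 2 <= c ^+ 2 * submxnorm z ^+ 2.
Proof.
move=> ac [|n] z; first by rewrite big_ord0 mulr_ge0 ?sqr_ge0.
have c0 : 0 <= c by rewrite -lee_fin -ac cbnorm_ge0.
have aE : l2norm (\col_i a (z i 0)) ^+ 2 = \sum_i rnorm (a (z i 0)) ^+ 2.
  by rewrite sqr_l2norm; apply: eq_bigr => i _; rewrite mxE.
rewrite -aE -exprMn ler_pXn2r ?nnegrE ?mulr_ge0 ?l2norm_ge0 ?submxnorm_ge0//.
apply: (@le_small _ _ _ c) => // e /andP[e0 _].
pose r := submxnorm z + e; have r0 : 0 < r by rewrite ltr_wpDl ?submxnorm_ge0.
have ri : 0 <= r^-1 by rewrite invr_ge0 ltW.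
pose X : 'M[A]_n.+1 :=
  \matrix_(i, j) if j == 0 then (r^-1)%:C%C *: z i 0 else 0.
have X1 : submxnorm X <= 1.
  apply: opmxnorm_le => // v; rewrite mul1r l2norm_le ?l2norm_ge0//.
  apply: le_trans (_ : r^-1 ^+ 2 * (submxnorm z ^+ 2 * rnorm (v 0 0) ^+ 2) <=
    _).
    apply: le_trans (ler_wpM2l (sqr_ge0 _) (le_col_submxnorm z (v 0 0))).
    rewrite mulr_sumr; apply: ler_sum => i _;
      rewrite mxE (bigD1 0)//= big1 ?addr0.
      by rewrite !mxE eqxx sub_valZ bopZ rnormZ exprMn rnorm_realC ger0_norm.
    by move=> j j0; rewrite !mxE (negbTE j0).
  rewrite mulrA -exprMn -exprMn ler_pXn2r ?nnegrE ?mulr_ge0 ?rnorm_ge0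
    ?submxnorm_ge0 ?l2norm_ge0//.
  apply: le_trans (le_l2norm v 0); rewrite ler_piMl ?rnorm_ge0//.
  by rewrite ler_pdivrMl// mulr1 lerDl ltW.
(* Testing X on the first basis vector recovers the column. *)
pose l : 'cV[R[i]]_n.+1 := \col_j (if j == 0 then 1 else 0).
have l1 : l2norm l <= 1.
  rewrite l2norm_le// (bigD1 0)//= big1 ?addr0 => [|j j0].
    by rewrite mxE eqxx rnorm1.
  by rewrite mxE (negbTE j0) rnorm0 expr0n.
have := cbnorm_ub a X1; rewrite ac lee_fin.
move/(le_trans (le_colmxnorm (map_mx a X) l1)).
have -> : \col_i \sum_j l j 0 *: map_mx a X i j =
  \col_i ((r^-1)%:C%C *: a (z i 0)).
  apply/matrixP => i k; rewrite !mxE (bigD1 0)//= big1 ?addr0 => [|j j0].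
    by rewrite !mxE eqxx scale1r linearZ.
  by rewrite mxE (negbTE j0) scale0r.
rewrite l2normZ rnorm_realC ger0_norm// ler_pdivrMl// /r => /le_trans; apply.
by rewrite mulrC mulrDr (mulrC e).
Qed.

(** For the vector map x |-> pi(x) xi, contractivity of pi on the single
    element sum z_i^* z_i already bounds it on the column z. *)
Lemma star_rep_column (pi : {linear cstar A -> 'B(K)}) (xi : K) :
  is_star_rep pi -> rnorm xi = 1 -> forall n (z : 'cV[A]_n),
    \sum_i rnorm (pi (cstar_incl (z i 0)) xi) ^+ 2 <= submxnorm z ^+ 2.
Proof.
move=> pi_rep xi1 n z; have [piM pi_adj] := pi_rep.
have -> : \sum_i rnorm (pi (cstar_incl (z i 0)) xi) ^+ 2 =
    complex.Re (inner (pi (cstar_gram z) xi) xi).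
  rewrite /cstar_gram raddf_sum bop_sum Re_innerC inner_sumr Re_sum.
  by apply: eq_bigr => i _; rewrite /= piM pi_adj Re_innerC /= -opadjPr
    inner_self.
rewrite (le_trans (Re_le_rnorm _))// (le_trans (Cauchy_Schwarz _ _))//
  xi1 mulr1.
rewrite (le_trans (le_opnorm _ _))// xi1 mulr1.
exact: le_trans (star_rep_contractive pi_rep _) (opnorm_cstar_gram z).
Qed.

(** A row of scalars l turns a matrix X over A into the column of the
    combinations sum_j l_j X_ij, of norm at most that of X; this is why
    bounds on columns suffice when the target is a column Hilbert space. *)
Lemma cbnorm_le1 (a : {linear A -> K}) :
  (forall n (z : 'cV[A]_n), \sum_i rnorm (a (z i 0)) ^+ 2 <=
    submxnorm z ^+ 2) ->
  (cbnorm a <= 1)%E.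
Proof.
move=> az; apply: ge_ereal_sup => _ [n [X [X1 ->]]]; rewrite lee_fin.
apply: ge_sup => [|_ [l /= l1 <-]].
  exists (l2norm (\col_i \sum_j (\col_k 0 :
    'cV[R[i]]_n) j 0 *: map_mx a X i j)).
  by exists (\col_k 0) => //=; rewrite l2norm0.
pose z : 'cV[A]_n := \col_i \sum_j l j 0 *: X i j.
have -> : \col_i \sum_j l j 0 *: map_mx a X i j = \col_i a (z i 0).
  apply/matrixP => i k; rewrite !mxE linear_sum; apply: eq_bigr => j _.
  by rewrite mxE linearZ.
rewrite l2norm_le// expr1n; under eq_bigr do rewrite mxE.
rewrite (le_trans (az _ z))// expr_le1 ?submxnorm_ge0//.
apply: col_submxnorm_le => // v; rewrite expr1n mul1r.
pose w : 'cV[H]_n := \col_j (l j 0 *: v).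
have := le_opmxnorm (map_mx val X) w.
have lw : l2norm w ^+ 2 <= rnorm v ^+ 2.
  rewrite sqr_l2norm; under eq_bigr do rewrite mxE rnormZ exprMn.
  by rewrite -mulr_suml -sqr_l2norm ler_piMl ?sqr_ge0// expr_le1 ?l2norm_ge0.
have -> : \sum_i rnorm (val (z i 0) v) ^+ 2 =
  l2norm (opmx_apply (map_mx val X) w) ^+ 2.
  rewrite sqr_l2norm; apply: eq_bigr => i _; congr (rnorm _ ^+ 2).
  rewrite !mxE sub_val_sum bop_sum; apply: eq_bigr => j _.
  by rewrite !mxE sub_valZ bopZ linearZ.
move=> Xw; apply: le_trans lw; rewrite ler_pXn2r ?nnegrE ?l2norm_ge0//.
by apply: (le_trans Xw); rewrite ler_piMl ?l2norm_ge0.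
Qed.

(** The bound on the dual norm is applied to the seminorm |b|^(1/2) |a x|. *)
Lemma factorization_whdual (T : {biscalar A}) (a : {linear A -> K})
    (b : bop K (conjugate K)) :
  (cbnorm a < +oo)%E -> biscalar_map T = transpose a \o b \o a ->
  (cbnorm a ^+ 2 * (opnorm b)%:E <= 1)%E -> (whdualnorm T <= 1)%E.
Proof.
move=> a_fin Tab ab1.
have [c ac] : exists c : R, cbnorm a = c%:E.
  by case: (cbnorm a) (cbnorm_ge0 a) a_fin => // c _ _; exists c.
have cb : c ^+ 2 * opnorm b <= 1 by move: ab1;
  rewrite ac -EFin_expe -EFinM lee_fin.
pose alpha x := Num.sqrt (opnorm b) * rnorm (a x).
apply: (@whdual_le1 _ _ _ _ alpha) => [x|x y|n z].
- by rewrite mulr_ge0 ?sqrtr_ge0 ?rnorm_ge0.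
- have -> : T x y = inner (b (a y)) (bar (a x)).
    by have /(congr1 (fun f => f y x)) := Tab.
  have -> : alpha x * alpha y = opnorm b * rnorm (a y) * rnorm (a x).
    by rewrite /alpha mulrACA -expr2 sqr_sqrtr ?opnorm_ge0//
      (mulrC (rnorm _)) mulrA.
  rewrite (le_trans (Cauchy_Schwarz _ _))// ler_wpM2r ?rnorm_ge0//.
  exact: le_opnorm.
- under eq_bigr do rewrite /alpha exprMn sqr_sqrtr ?opnorm_ge0//.
  rewrite -mulr_sumr (le_trans (ler_wpM2l (opnorm_ge0 b) (cbnorm_column ac
    z)))//.
  by rewrite mulrA ler_piMl ?sqr_ge0// mulrC.
Qed.

End ColumnSpace.

Theorem theorem3p2 (R : realType) (H : hilbertType R)
    (A : submodClosed 'B(H)) (A_neq0 : exists x : A, x != 0)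
    (T : {biscalar A}) :
  [<-> (whdualnorm T <= 1)%E;
       exists p0 : {scalar cstar A}, is_state p0 /\
         forall x y : A, `|T x y| <=
           sqrtC (p0 (cstar_mul (cstar_adj (cstar_incl x)) (cstar_incl x))) *
           sqrtC (p0 (cstar_mul (cstar_adj (cstar_incl y)) (cstar_incl y)));
       exists (K : hilbertType R) (pi : {linear cstar A -> 'B(K)})
              (xi : K) (b : bop K (conjugate K)),
         [/\ is_star_rep pi, `|xi| = 1, opnorm b <= 1 &
             forall x y : A, T x y =
               inner (b (pi (cstar_incl y) xi)) (bar (pi (cstar_incl x) xi))];
       exists (K : hilbertType R) (a : {linear A -> K})
              (b : bop K (conjugate K)),
         [/\ (cbnorm a < +oo)%E,
             biscalar_map T = transpose a \o b \o a &
             (cbnorm a ^+ 2 * (opnorm b)%:E <= 1)%E]].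
Proof.
tfae.
- exact: whdual_state.
(* A state on C*(A) is first turned back into the bound on the dual norm. *)
- by move=> [p0 [p0s Tp0]]; apply: whdual_representation => //;
    exact: state_whdual p0s Tp0.
- move=> [K [pi [xi [b [pi_rep xi1 b1 bT]]]]].
  have nxi : rnorm xi = 1 by rewrite /rnorm xi1.
  have [a aE] : exists a : {linear A -> K}, forall x, a x =
    pi (cstar_incl x) xi.
    apply: ex_linear => c x y.
    have -> : cstar_incl (c *: x + y) = c *: cstar_incl x + cstar_incl y
      by exact: val_inj.
    by rewrite linearP.
  have a1 : (cbnorm a <= 1)%E.
    apply: cbnorm_le1 => n z; under eq_bigr do rewrite aE.
    exact: star_rep_column.
  have [c ac] : exists c : R, cbnorm a = c%:E.
    by case: (cbnorm a) (cbnorm_ge0 a) a1 => // c _ _; exists c.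
  have c0 : 0 <= c by rewrite -lee_fin -ac cbnorm_ge0.
  have c1 : c <= 1 by rewrite -lee_fin -ac.
  exists K, a, b; split; first by rewrite ac ltry.
    by apply/funext => y; apply/funext => x;
      rewrite /biscalar_map /transpose /= bT !aE.
  rewrite ac -EFin_expe -EFinM lee_fin.
  by rewrite mulr_ile1 ?opnorm_ge0 ?sqr_ge0 ?expr_le1.
- by move=> [K [a [b [a_fin Tab ab1]]]];
    exact: factorization_whdual a_fin Tab ab1.
Qed.
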